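(* Let $1<p<\infty$ and let $\nu:\mathbb{R}^d\setminus\{0\}\to[0,\infty)$ be measurable and symmetric ($\nu(h)=\nu(-h)$). The following assertions are equivalent. (i) $\nu\in L^1(\mathbb{R}^d,1\wedge|h|^p)$, i.e. $\int_{\mathbb{R}^d}(1\wedge|h|^p)\nu(h)\,dh<\infty$. (ii) The embedding $W^{1,p}(\mathbb{R}^d)\hookrightarrow W^p_\nu(\mathbb{R}^d)$ is continuous. (iii) $\mathcal{E}_{\mathbb{R}^d}(u,u)<\infty$ for all $u\in W^{1,p}(\mathbb{R}^d)$. (iv) $\mathcal{E}_{\mathbb{R}^d}(u,u)<\infty$ for all $u\in C_c^\infty(\mathbb{R}^d)$. Moreover, this remains true when $p=1$ with $BV(\mathbb{R}^d)$ in place of $W^{1,1}(\mathbb{R}^d)$.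
   Context: $a\wedge b=\min(a,b)$. $\mathcal{E}_{\mathbb{R}^d}(u,u)=\int_{\mathbb{R}^d}\int_{\mathbb{R}^d}|u(x)-u(y)|^p\nu(x-y)\,dy\,dx$, and $W^p_\nu(\mathbb{R}^d)=\{u\in L^p(\mathbb{R}^d):\mathcal{E}_{\mathbb{R}^d}(u,u)<\infty\}$ with norm $(\|u\|^p_{L^p(\mathbb{R}^d)}+\mathcal{E}_{\mathbb{R}^d}(u,u))^{1/p}$. $W^{1,p}(\mathbb{R}^d)$ is the classical Sobolev space; $BV(\mathbb{R}^d)$ the space of functions of bounded variation. *)

(* Defs.v *)
From HB Require Import structures.
From mathcomp Require Import all_boot all_order all_algebra.
From mathcomp Require Import all_classical all_reals all_analysis.
From mathcomp Require Import measurable_realfun.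

Set Implicit Arguments.
Unset Strict Implicit.
Unset Printing Implicit Defensive.

Import Order.TTheory GRing.Theory Num.Theory.
Import numFieldNormedType.Exports.

Local Open Scope classical_set_scope.
Local Open Scope ring_scope.

Section measurable_rV.
Context {R : realType} (n : nat).

(* The sigma-algebra generated by the coordinates, as in the library's instance
   on tuples; over a realType it is the Borel sigma-algebra of R^n. *)
Let coord (i : 'I_n) (x : 'rV[R]_n) : measurableTypeR R := x ord0 i.

Let rV_set0 : g_sigma_preimage coord set0.
Proof. exact: sigma_algebra0. Qed.

Let rV_setC A : g_sigma_preimage coord A -> g_sigma_preimage coord (~` A).
Proof. exact: sigma_algebraC. Qed.

Let rV_bigcup (F : (set 'rV[R]_n)^nat) :
  (forall i, g_sigma_preimage coord (F i)) ->
  g_sigma_preimage coord (\bigcup_i F i).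
Proof. exact: sigma_algebra_bigcup. Qed.

HB.instance Definition _ := @isMeasurable.Build default_measure_display
  'rV[R]_n (g_sigma_preimage coord) rV_set0 rV_setC rV_bigcup.

End measurable_rV.

Lemma measurable_coord (R : realType) n (i : 'I_n) :
  measurable_fun [set: 'rV[R]_n] (fun x => x ord0 i : measurableTypeR R).
Proof.
move=> _ Y mY; rewrite setTI; apply: sub_sigma_algebra => /=.
rewrite -bigcup_seq/=; exists i => /=; first by rewrite mem_index_enum.
by exists Y => //; rewrite setTI.
Qed.

Lemma measurable_fun_rVP d (T : measurableType d) (R : realType) n
    (f : T -> 'rV[R]_n) :
  (forall i, measurable_fun [set: T] (fun x => f x ord0 i : measurableTypeR R)) ->
  measurable_fun [set: T] f.
Proof.
move=> mf _ Y mY; rewrite setTI.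
pose M : set (set 'rV[R]_n) := [set A | measurable (f @^-1` A)].
suff : @measurable _ 'rV[R]_n `<=` M by exact.
apply: smallest_sub.
  split => [|A MA|F MF]; rewrite /M/=.
  - by rewrite preimage_set0.
  - by rewrite setTD preimage_setC; exact: measurableC.
  - by rewrite preimage_bigcup; exact: bigcupT_measurable.
rewrite -bigcup_seq/= => A [i _] [B mB <-]; rewrite /M/= setTI.
by have := mf i measurableT B mB; rewrite setTI.
Qed.

Section rV_cons.
Context {R : realType} {n : nat}.

Definition rV_cons (z : measurableTypeR R * 'rV[R]_n) : 'rV[R]_n.+1 :=
  \row_i oapp (z.2 ord0) z.1 (unlift ord0 i).

Definition rV_uncons (x : 'rV[R]_n.+1) : measurableTypeR R * 'rV[R]_n :=
  (x ord0 ord0, \row_i x ord0 (lift ord0 i)).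

Lemma rV_cons0 z : rV_cons z ord0 ord0 = z.1.
Proof. by rewrite mxE unlift_none. Qed.

Lemma rV_consS z i : rV_cons z ord0 (lift ord0 i) = z.2 ord0 i.
Proof. by rewrite mxE liftK. Qed.

Lemma rV_consK : cancel rV_cons rV_uncons.
Proof.
move=> [x y]; rewrite /rV_uncons rV_cons0; congr pair.
by apply/rowP => i; rewrite mxE rV_consS.
Qed.

Lemma rV_unconsK : cancel rV_uncons rV_cons.
Proof.
move=> x; apply/rowP => i; case: (unliftP ord0 i) => [j ->|->].
  by rewrite rV_consS mxE.
by rewrite rV_cons0.
Qed.

Lemma measurable_rV_cons : measurable_fun [set: _] rV_cons.
Proof.
apply: measurable_fun_rVP => i; case: (unliftP ord0 i) => [j ->|->].
  under eq_fun do rewrite rV_consS.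
  by apply: (measurableT_comp (measurable_coord j)); exact: measurable_snd.
under eq_fun do rewrite rV_cons0.
exact: measurable_fst.
Qed.

Lemma measurable_rV_uncons : measurable_fun [set: _] rV_uncons.
Proof.
apply: measurable_fun_pair; first exact: measurable_coord.
apply: measurable_fun_rVP => i; under eq_fun do rewrite mxE.
exact: measurable_coord.
Qed.

Variable m : {sigma_finite_measure set 'rV[R]_n -> \bar R}.

Definition leb_succ : set 'rV[R]_n.+1 -> \bar R :=
  pushforward (@lebesgue_measure R \x m)%E rV_cons.

Let leb_succ0 : leb_succ set0 = 0%E.
Proof. by rewrite /leb_succ /pushforward preimage_set0 measure0. Qed.

Let leb_succ_ge0 A : (0 <= leb_succ A)%E.
Proof. by rewrite /leb_succ /pushforward; exact: measure_ge0. Qed.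

Let leb_succ_sigma_additive : semi_sigma_additive leb_succ.
Proof.
move=> F mF tF mUF; rewrite /leb_succ /pushforward preimage_bigcup.
apply: measure_semi_sigma_additive.
- by move=> n'; rewrite -[X in measurable X]setTI; exact: measurable_rV_cons.
- apply/trivIsetP => /= i j _ _ ij; rewrite -preimage_setI.
  by move/trivIsetP : tF => /(_ _ _ _ _ ij) ->//; rewrite preimage_set0.
- rewrite -preimage_bigcup -[X in measurable X]setTI.
  exact: measurable_rV_cons.
Qed.

HB.instance Definition _ := isMeasure.Build _ _ _ leb_succ
  leb_succ0 leb_succ_ge0 leb_succ_sigma_additive.

Let leb_succ_sigma_finite : sigma_finite setT leb_succ.
Proof.
have /sigma_finiteP[F [TF ndF Foo]] := sigma_finiteT (@lebesgue_measure R).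
have /sigma_finiteP[G [TG ndG Goo]] := sigma_finiteT m.
have mFG k : measurable (F k `*` G k).
  by apply: measurableX; [case: (Foo k)|case: (Goo k)].
exists (fun k => rV_uncons @^-1` (F k `*` G k)).
  apply/seteqP; split => // x _.
  have [k _ Fk] : (\bigcup_k F k) (rV_uncons x).1 by rewrite -TF.
  have [l _ Gl] : (\bigcup_k G k) (rV_uncons x).2 by rewrite -TG.
  exists (maxn k l) => //; split.
    by move: Fk; exact/subsetPset/ndF/leq_maxl.
  by move: Gl; exact/subsetPset/ndG/leq_maxr.
move=> k; have [mF Fk] := Foo k; have [mG Gk] := Goo k; split.
  by rewrite -[X in measurable X]setTI; exact: measurable_rV_uncons.
rewrite /leb_succ /pushforward -comp_preimage.
rewrite (_ : _ \o _ = id) ?preimage_id; last exact/funext/rV_consK.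
by rewrite product_measure1E// lte_mul_pinfty// ge0_fin_numE.
Qed.

HB.instance Definition _ := Measure_isSigmaFinite.Build _ _ _ leb_succ
  leb_succ_sigma_finite.

End rV_cons.

(* On R^0, which is a point, Lebesgue measure is the Dirac mass; on R^(n+1) it
   is the image of the product of the Lebesgue measures of R and R^n. *)
Fixpoint leb (R : realType) (n : nat) :
    {sigma_finite_measure set 'rV[R]_n -> \bar R} :=
  if n is m.+1 then leb_succ (leb R m) else dirac (0 : 'rV[R]_0).
Arguments leb {R n}.

Lemma measurable_box (R : realType) n (A : 'I_n -> set (measurableTypeR R)) :
  (forall i, measurable (A i)) ->
  measurable [set x : 'rV[R]_n | forall i, A i (x ord0 i)].
Proof.
move=> mA; rewrite (_ : [set _ | _] =
    \big[setI/setT]_(i < n) ((fun x : 'rV[R]_n => x ord0 i) @^-1` A i)).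
  apply: bigsetI_measurable => i _; rewrite -[X in measurable X]setTI.
  exact: measurable_coord.
rewrite -bigcap_seq; apply/seteqP; split => [x Ax i _|x Ax i]; first exact: Ax.
by apply: (Ax i); rewrite /= mem_index_enum.
Qed.

(* Lebesgue measure is the measure giving every box its volume. *)
Lemma leb_box (R : realType) n (A : 'I_n -> set (measurableTypeR R)) :
  (forall i, measurable (A i)) ->
  leb [set x : 'rV[R]_n | forall i, A i (x ord0 i)] =
  (\prod_(i < n) @lebesgue_measure R (A i))%E.
Proof.
elim: n A => [|n IHn] A mA.
  by rewrite big_ord0 /= diracE mem_set// => -[].
rewrite big_ord_recl -IHn//= /leb_succ /pushforward.
rewrite -product_measure1E//; last first.
  exact: (measurable_box (A := fun i => A (lift ord0 i))).
congr product_measure1; apply/seteqP; split => [[x y]/= Az|[x y]/= [Ax Ay] i].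
  split; first by have := Az ord0; rewrite rV_cons0.
  by move=> i; have := Az (lift ord0 i); rewrite rV_consS.
by case: (unliftP ord0 i) => [j ->|->]; rewrite ?rV_consS ?rV_cons0.
Qed.

Section spaces.
Context {R : realType} {d : nat}.
Local Notation Rd := 'rV[R]_d.
Implicit Types (p : R) (u : Rd -> R) (nu : Rd -> R).

(* The measurable sets of the domain are the Lebesgue-measurable ones: Borel up
   to a subset of a Borel null set. *)
Definition lebesgue_measurable_fun (D : set Rd) (f : Rd -> R) :=
  measurable_fun
    (D : set (g_sigma_algebraType (completed_algebra_gen (@leb R d)))) f.

(* The norm `|x| of the library on row vectors is the sup norm. *)
Definition enorm (x : Rd) : R := Num.sqrt (\sum_i x ord0 i ^+ 2).

Definition partial (i : 'I_d) (f : Rd -> R) : Rd -> R :=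
  fun x => 'D_(delta_mx ord0 i) f x.

Definition smooth (f : Rd -> R) := forall s : seq 'I_d,
  continuous (foldr partial f s) /\
  forall x i, derivable (foldr partial f s) x (delta_mx ord0 i).

Definition Cc_smooth : set (Rd -> R) :=
  [set f | smooth f /\ compact (closure [set x | f x != 0])].

(* Elements of L^p, and of the spaces below, are represented by Borel functions:
   every class modulo equality a.e. contains one, and all the quantities below
   are invariant under modification on a null set.

   nu is only meaningful off the origin; its junk value nu 0 is always multiplied
   by 0 (here |u x - u x| `^ p, in Levy_integral the factor 0 `^ p).  When nu is
   Lebesgue but not Borel measurable, the integrals of these nonnegative
   functions, being suprema of integrals of Borel simple functions, still have
   the usual value. *)
Definition energy nu p u : \bar R :=
  (\int[leb]_x \int[leb]_y (`|u x - u y| `^ p * nu (x - y))%:E)%E.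

Definition Levy_integral nu p : \bar R :=
  (\int[leb]_h (Num.min 1 (enorm h `^ p) * nu h)%:E)%E.

Definition Wnu nu p : set (Rd -> R) :=
  [set u | u \in Lfun leb p%:E /\ (energy nu p u < +oo)%E].

Definition Wnu_norm nu p u : \bar R :=
  ((Lnorm leb p%:E (EFin \o u) `^ p + energy nu p u) `^ p^-1)%E.

Definition weak_gradient p u : set (Rd -> Rd) :=
  [set g | (forall i, (fun x => g x ord0 i) \in Lfun leb p%:E) /\
    forall i phi, Cc_smooth phi ->
      (\int[leb]_x (u x * partial i phi x)%:E =
       - \int[leb]_x (g x ord0 i * phi x)%:E)%E].

Definition W1p p : set (Rd -> R) :=
  [set u | u \in Lfun leb p%:E /\ exists g, weak_gradient p u g].

(* The weak gradient of u is unique up to a null set, so that the value does not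
   depend on the one picked by get. *)
Definition W1p_norm p u : \bar R :=
  ((Lnorm leb p%:E (EFin \o u) `^ p +
    \int[leb]_x (enorm (get (weak_gradient p u) x) `^ p)%:E) `^ p^-1)%E.

Definition divergence (phi : Rd -> Rd) : Rd -> R :=
  fun x => \sum_i partial i (fun y => phi y ord0 i) x.

Definition variation u : \bar R := ereal_sup
  [set (\int[leb]_x (u x * divergence phi x)%:E)%E | phi in
    [set phi : Rd -> Rd | (forall i, Cc_smooth (fun x => phi x ord0 i)) /\
                          forall x, enorm (phi x) <= 1]].

Definition BV : set (Rd -> R) :=
  [set u | u \in Lfun leb 1%:E /\ (variation u < +oo)%E].

Definition BV_norm u : \bar R := (Lnorm leb 1%:E (EFin \o u) + variation u)%E.

Definition continuous_embedding (X : set (Rd -> R)) (normX : (Rd -> R) -> \bar R)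
    (Y : set (Rd -> R)) (normY : (Rd -> R) -> \bar R) :=
  X `<=` Y /\ exists C : R, forall u, X u -> (normY u <= C%:E * normX u)%E.

End spaces.

(* Main.v *)
Require Import Defs.
From HB Require Import structures.
From mathcomp Require Import all_boot all_order all_algebra.
From mathcomp Require Import all_classical all_reals all_analysis.
From mathcomp Require Import measurable_realfun lra ring.

(** Write F(h) for the integral of |u(x + h) - u(x)|^p over x. By the symmetry of
    the kernel, the substitution y = x + h and Tonelli's theorem, the energy of u is
    the integral of nu(h) F(h) (lemma energy_incr), so everything reduces to
    comparing F(h) with min(1, |h|^p).

    Upper bound. F(h) is at most a multiple of the p-th power of the L^p norm of u.
    For small h, telescoping along the coordinate axes (incr_axes) reduces the
    estimate to translations by t e_i. The increment w = u(. + t e_i) - u is paired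
    with a test function phi: moving the translation onto phi turns the pairing into
    an average over s in [0, 1] of the integrals of - t u times the i-th partial
    derivative of phi(. - s t e_i) (shift_pairing). For u in BV each of these is at
    most |t| times the variation of u if |phi| <= 1, and duality bounds the L^1 norm
    of w (BV_shift_le). For u in W^(1,p) with weak gradient g, the pairing is at most
    the integral of |phi| against |t| times the average of |g_i| over the segment
    swept by the translation; hence |w| is bounded almost everywhere by the latter,
    and Jensen's inequality gives the L^p bound (W1p_shift_le). Both conclusions
    come from integral_excess_le, which rests on the density of smooth functions in
    L^1 of a finite measure (measurable_approximable): the sets whose indicator can
    be approximated form a sigma-algebra that contains the half-spaces.

    Lower bound. Finitely many smooth functions of compact support suffice: a bump
    gives F(h) >= v > 0 for large h, and for the remaining h a function equal to x_i
    on a large ball gives F(h) >= v |h_i|^p, so that some combination of the F's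
    dominates min(1, |h|^p) (incr_ge_min). Integrating against nu bounds the Levy
    integral by energies.

    Smooth functions of compact support belong to W^(1,p) and to BV by integration
    by parts, itself a consequence of translation invariance (integral_partial0).
    The kernel is only Lebesgue measurable; off a null set it is a Borel function
    (borel_version), and the integrals of nonnegative functions are not changed by
    the replacement (ge0_integral_eq_off_null). *)

Set Implicit Arguments.
Unset Strict Implicit.
Unset Printing Implicit Defensive.

Import Order.TTheory GRing.Theory Num.Theory.
Import numFieldNormedType.Exports.

Local Open Scope classical_set_scope.
Local Open Scope ring_scope.

(** * Borel sets and translations of R^n *)

Section borel.
Context {R : realType}.

(** The sigma-algebra is generated by coordinates, so it contains the open sets
    because each of them is a union of the countably many cubes with rational
    centre and radius 1/k that it contains. *)
Lemma open_measurable_rV n (A : set 'rV[R]_n) : open A -> measurable A.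
Proof.
move=> oA.
pose B (i : 'rV[rat]_n * nat) : set 'rV[R]_n :=
  [set x | forall j, ball (ratr (i.1 ord0 j) : R) i.2.+1%:R^-1 (x ord0 j)].
pose C i := if `[< B i `<=` A >] then B i else set0.
have -> : A = \bigcup_i C i.
  apply/seteqP; split => [x Ax|x [i _]]; last first.
    by rewrite /C; case: ifPn => // /asboolP; exact.
  have /nbhs_ballP[e /= e0 eA] : nbhs x A by exact: open_nbhs_nbhs.
  have e20 : 0 < e / 2 by rewrite divr_gt0.
  have [k _ /(_ k (leqnn k))/= ke] := near_infty_natSinv_lt (PosNum e20).
  have k0 : 0 < k.+1%:R^-1 :> R by rewrite invr_gt0.
  have qP j : {q : rat | ratr q \in `](x ord0 j - k.+1%:R^-1), (x ord0 j + k.+1%:R^-1)[}.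
    by apply/cid; apply: rat_in_itvoo; rewrite ltrBlDr -addrA ltrDl addr_gt0.
  pose q : 'rV[rat]_n := \row_j sval (qP j).
  exists (q, k) => //; rewrite /C.
  have Bx : B (q, k) x.
    move=> j /=; rewrite mxE; have := svalP (qP j); rewrite in_itv/= => /andP[? ?].
    by rewrite /ball/= ltr_norml ltrBrDr ltrBlDl addrC; apply/andP.
  rewrite asboolT// => y By; apply: eA; split => // i j; rewrite ord1.
  have := By j; have := Bx j; rewrite /ball/= => h1 h2.
  rewrite (_ : _ - _ = (x ord0 j - ratr (q ord0 j)) + (ratr (q ord0 j) - y ord0 j)); last by ring.
  by rewrite (le_lt_trans (ler_normD _ _))// distrC (splitr e) ltrD// (lt_trans _ ke).
apply: countable_bigcupT_measurable => [|i]; [exact: countableP|rewrite /C]; case: ifPn => // _.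
apply: (measurable_box (A := fun j => ball (ratr (i.1 ord0 j) : R) i.2.+1%:R^-1)).
by move=> j; exact: measurable_ball.
Qed.

Lemma continuous_measurable_rV n (f : 'rV[R]_n -> R) :
  continuous f -> measurable_fun [set: 'rV[R]_n] f.
Proof.
move=> /continuousP cf; apply: (measurability (@RGenOpens.G R)).
  exact: RGenOpens.measurableE.
move=> _ [_ [a [b ->]] <-]; rewrite setTI; apply: open_measurable_rV.
by apply: cf; exact: interval_open.
Qed.

Lemma measurable_addr_rV n d (T : measurableType d) (f g : T -> 'rV[R]_n) :
  measurable_fun [set: T] f -> measurable_fun setT g ->
  measurable_fun setT (fun x => f x + g x).
Proof.
move=> mf mg; apply: measurable_fun_rVP => i; under eq_fun do rewrite mxE.
by apply: measurable_funD; apply: (measurableT_comp (measurable_coord i)).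
Qed.

Lemma measurable_scaler_rV n d (T : measurableType d) (a : T -> R) (v : 'rV[R]_n) :
  measurable_fun setT a -> measurable_fun setT (fun x => a x *: v).
Proof.
move=> ma; apply: measurable_fun_rVP => i; under eq_fun do rewrite mxE.
exact: measurable_funM.
Qed.

Lemma lebesgue_measure_shift (a : R) (A : set (measurableTypeR R)) : measurable A ->
  lebesgue_measure ((fun t => t + a) @^-1` A) = lebesgue_measure A.
Proof.
move=> mA.
have mS : measurable_fun setT ((fun t => t + a) : R -> R).
  exact: measurable_funD.
rewrite -[LHS]/(pushforward lebesgue_measure ((fun t => t + a) : _ -> measurableTypeR R) A).
apply/esym/lebesgue_measure_unique => //= _ [[b c]] _ <-.
rewrite /pushforward (_ : _ @^-1` _ = `](b - a), (c - a)]%classic); last first.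
  by apply/seteqP; split => x /=; rewrite !in_itv/= ltrBlDr lerBrDr.
rewrite !lebesgue_measure_itv/= !lte_fin ltrD2r; case: ifP => // _.
by rewrite -!EFinD; congr EFin; ring.
Qed.

Lemma measurable_shift n (h : 'rV[R]_n) : measurable_fun [set: 'rV[R]_n] (fun x : 'rV[R]_n => x + h).
Proof. by apply: measurable_addr_rV. Qed.

(** Lebesgue measure on R^(n+1) is an image of a product, and a translation acts
    on both factors. *)
Lemma leb_shift n (h : 'rV[R]_n) (A : set 'rV[R]_n) : measurable A ->
  leb ((+%R^~ h) @^-1` A) = leb A.
Proof.
elim: n h A => [|n IHn] h A mA.
  by congr (leb _); apply/seteqP; split => x /=; rewrite [_ + _]thinmx0 [x]thinmx0.
have mC := @measurable_rV_cons R n.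
have mCA : measurable (rV_cons @^-1` A) by rewrite -[X in measurable X]setTI; exact: mC.
rewrite /= /leb_succ /pushforward.
pose h' : 'rV[R]_n := \row_i h ord0 (lift ord0 i).
have E t : xsection (rV_cons @^-1` ((+%R^~ h) @^-1` A)) t =
    (fun y => y + h') @^-1` xsection (rV_cons @^-1` A) (t + h ord0 ord0).
  apply/seteqP; split => y; rewrite /xsection/= !inE/=;
    (rewrite (_ : rV_cons (t, y) + h = rV_cons (t + h ord0 ord0, y + h'))//;
     apply/rowP => i; case: (unliftP ord0 i) => [j ->|->];
     by rewrite ?(mxE, rV_consS, rV_cons0) ?liftK ?unlift_none /= ?mxE).
rewrite /product_measure1.
under eq_integral => t _.
  rewrite /= E IHn; last exact: measurable_xsection.
  over.
pose F t : \bar R := leb (xsection (rV_cons @^-1` A) t).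
have mF : measurable_fun setT F by exact: measurable_fun_xsection.
pose sh (t : measurableTypeR R) : measurableTypeR R := t + h ord0 ord0.
have mS : measurable_fun setT sh by exact: (@measurable_funD _ _ R).
rewrite -[LHS]/(\int[lebesgue_measure]_(t in sh @^-1` setT) (F \o sh) t)%E.
rewrite -(@ge0_integral_pushforward _ _ _ (measurableTypeR R) R _ mS lebesgue_measure setT F)//.
apply: eq_measure_integral => B mB _.
exact: lebesgue_measure_shift.
Qed.

Lemma ge0_integral_shift n (h : 'rV[R]_n) (f : 'rV[R]_n -> \bar R) :
  measurable_fun setT f -> (forall x, 0 <= f x)%E ->
  (\int[leb]_x f (x + h)%R = \int[leb]_x f x)%E.
Proof.
move=> mf f0.
rewrite -[LHS]/(\int[leb]_(x in (+%R^~ h) @^-1` setT) (f \o (+%R^~ h)) x)%E.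
rewrite -(ge0_integral_pushforward (measurable_shift h))//.
apply: eq_measure_integral => [|mT A mA _]; [exact: measurable_shift|exact: leb_shift].
Qed.

Lemma integral_shift n (h : 'rV[R]_n) (f : 'rV[R]_n -> \bar R) :
  measurable_fun setT f -> (\int[leb]_x f (x + h)%R = \int[leb]_x f x)%E.
Proof.
move=> mf; rewrite integralE [RHS]integralE.
congr (_ - _)%E.
  by rewrite -[RHS](ge0_integral_shift h (measurable_funepos mf)) => [|x]; [by apply: eq_integral => x _; rewrite !funeposE|exact: funepos_ge0].
by rewrite -[RHS](ge0_integral_shift h (measurable_funeneg mf)) => [|x]; [by apply: eq_integral => x _; rewrite !funenegE|exact: funeneg_ge0].
Qed.

Lemma integrable_shift n (h : 'rV[R]_n) (f : 'rV[R]_n -> \bar R) :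
  leb.-integrable setT f -> leb.-integrable setT (fun x => f (x + h)).
Proof.
move=> /integrableP[mf fi]; apply/integrableP; split.
  by apply: (measurableT_comp mf); exact: measurable_shift.
by rewrite (ge0_integral_shift h (f := fun x => `|f x|%E))//; exact: measurableT_comp.
Qed.

End borel.

(** * Completion: replacing a Lebesgue measurable function by a Borel one *)

Section completion.
Import HBNNSimple.
Context d (T : measurableType d) (R : realType).
Variable mu : {measure set T -> \bar R}.

(** The integral of a nonnegative function is a supremum over the simple
    functions below it, and these can be cut off on a null set: measurability of
    the two functions is not at stake. *)
Lemma ge0_integral_eq_off_null (N : set T) (f g : T -> \bar R) :
  measurable N -> mu N = 0%E ->
  (forall x, (0 <= f x)%E) -> (forall x, (0 <= g x)%E) ->
  (forall x, ~ N x -> f x = g x) ->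
  (\int[mu]_x f x = \int[mu]_x g x)%E.
Proof.
move=> mN N0.
suff le f1 f2 : (forall x, (0 <= f1 x)%E) -> (forall x, (0 <= f2 x)%E) ->
    (forall x, ~ N x -> f1 x = f2 x) -> (\int[mu]_x f1 x <= \int[mu]_x f2 x)%E.
  move=> f0 g0 fg; apply/eqP; rewrite eq_le !le// => x Nx.
  by rewrite fg.
move=> f10 f20 f12; rewrite ge0_integralTE//; apply: ge_ereal_sup => _ [h hf <-].
have mNc : measurable (~` N) by exact: measurableC.
pose k := mul_nnsfun h (indic_nnsfun R mNc).
have -> : sintegral mu h = sintegral mu k.
  rewrite -!integralT_nnsfun; apply: ge0_ae_eq_integral => //.
  - by apply/measurable_EFinP.
  - by apply/measurable_EFinP.
  - by move=> x _; rewrite lee_fin.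
  - by move=> x _; rewrite lee_fin.
  exists N; split => // x /= /not_implyP[_] hk; apply: contrapT => Nx; apply: hk.
  by rewrite /= mindicE mem_set// mulr1.
rewrite ge0_integralTE//; apply: ereal_sup_ubound; exists k => // x.
rewrite /= mindicE; have [Nx|Nx] := pselect (N x).
  by rewrite memNset ?mulr0.
by rewrite mem_set// mulr1 -f12.
Qed.

(** The sets that agree with a measurable set off a null set form a
    sigma-algebra. *)
Lemma completed_measurable_ae (A : set T) :
  (completed_algebra_gen mu).-sigma.-measurable A ->
  exists B N, [/\ measurable B, measurable N, mu N = 0%E &
    forall x, ~ N x -> A x <-> B x].
Proof.
pose M : set (set T) := [set A | exists B N, [/\ measurable B, measurable N,
  mu N = 0%E & forall x, ~ N x -> A x <-> B x]].
suff : (completed_algebra_gen mu).-sigma.-measurable `<=` M by exact.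
apply: smallest_sub.
  split => [|C [B [N [mB mN N0 CB]]]|F MF].
  - by exists set0, set0; split => //; exact: measure0.
  - exists (~` B), N; split => //; first exact: measurableC.
    by move=> x /CB CBx; rewrite setTD /setC/=; split => + ?; apply; apply/CBx.
  - have /choice[B BP] := MF; have /choice[N NP] := BP.
    exists (\bigcup_k B k), (\bigcup_k N k); split.
    + by apply: bigcupT_measurable => k; case: (NP k).
    + by apply: bigcupT_measurable => k; case: (NP k).
    + apply/negligibleP; first by apply: bigcupT_measurable => k; case: (NP k).
      apply: negligible_bigcup => k; have [_ mN N0 _] := NP k.
      by apply/negligibleP.
    + move=> x Nx; split=> -[k _ kx]; exists k => //; have [_ _ _ FB] := NP k;
        by apply/FB => // Nkx; apply: Nx; exists k.
move=> _ [C mC [N [N' [mN' N'0 NN']]] <-].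
exists C, N'; split => // x N'x; split => [[//|/NN']|]; last by left.
by [].
Qed.

End completion.

Section borel_version.
Context {R : realType} (d : nat).

Lemma measurable_set1_rV (x : 'rV[R]_d) : measurable [set x].
Proof.
rewrite (_ : [set x] = [set y | forall i, [set x ord0 i] (y ord0 i)]).
  exact: (measurable_box (A := fun i => [set x ord0 i])).
by apply/seteqP; split => [_ ->//|y yx]; apply/rowP.
Qed.

Lemma leb_set1 (x : 'rV[R]_d) : (0 < d)%N -> leb [set x] = 0%E.
Proof.
move=> d0; rewrite (_ : [set x] = [set y | forall i, [set x ord0 i] (y ord0 i)]).
  rewrite (leb_box (A := fun i => [set x ord0 i]))// (bigD1 (Ordinal d0))//=.
  by rewrite lebesgue_measure_set1 mul0e.
by apply/seteqP; split => [_ ->//|y yx]; apply/rowP.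
Qed.

(** The superlevel sets at rational levels agree with Borel sets off a null set,
    and they determine the function. *)
Lemma borel_version (nu : 'rV[R]_d -> R) : (0 < d)%N ->
  lebesgue_measurable_fun [set~ 0] nu -> (forall h, h != 0 -> 0 <= nu h) ->
  exists (nu' : 'rV[R]_d -> R) N, [/\ measurable N, leb N = 0%E,
    measurable_fun setT nu', forall h, 0 <= nu' h & forall h, ~ N h -> nu' h = nu h].
Proof.
move=> d0 mnu nu0.
have m0 : (completed_algebra_gen (@leb R d)).-sigma.-measurable [set~ 0].
  apply: sub_sigma_algebra; exists [set~ 0]; last first.
    by exists set0; [exact: negligible_set0|rewrite setU0].
  by apply: measurableC; exact: measurable_set1_rV.
have lev (q : rat) : exists B N, [/\ measurable B, measurable N, leb N = 0%E &
    forall x, ~ N x -> (x != 0 /\ ratr q < nu x) <-> B x].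
  have mq : measurable (`]ratr q, +oo[%classic : set R) by [].
  have [B [N [mB mN N0 H]]] := completed_measurable_ae (mnu m0 _ mq).
  exists B, N; split => // x /H <-.
  rewrite /= in_itv/= andbT; split => -[/eqP ? ?]; split => //; exact/eqP.
have /choice[B BP] := lev; have /choice[N NP] := BP => {BP lev}.
(* An enumeration of the rationals, so that the exceptional sets form a sequence. *)
pose r k : rat := odflt 0 (unpickle k).
have rE q : exists k, r k = q by exists (pickle q); rewrite /r pickleK.
pose M := [set 0] `|` \bigcup_k N (r k).
have mM : measurable M.
  apply: measurableU; first exact: measurable_set1_rV.
  by apply: bigcupT_measurable => k; case: (NP (r k)).
have M0 : leb M = 0%E.
  apply/negligibleP => //; apply: negligibleU.
    by apply/negligibleP; [exact: measurable_set1_rV|exact: leb_set1].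
  apply: negligible_bigcup => k; have [_ mN N0 _] := NP (r k).
  by apply/negligibleP.
exists (nu \_ (~` M)), M; split => //.
- apply/(measurable_restrictT nu (measurableC mM)).
  apply: (measurability (@RGenOInfty.G R)); first exact: RGenOInfty.measurableE.
  move=> _ [_ [a ->] <-].
  rewrite (_ : _ `&` _ = \bigcup_k (if a < ratr (r k) then B (r k) `\` M else set0)).
    apply: bigcupT_measurable => k; case: ifPn => // _; apply: measurableD => //.
    by case: (NP (r k)).
  apply/seteqP; split => x /=.
    move=> [Mx]; rewrite in_itv/= andbT => /rat_in_itvoo[q]; rewrite in_itv/= => /andP[aq qx].
    have [k rk] := rE q; exists k => //; rewrite rk aq; split => //.
    have [_ _ _ H] := NP q; apply/H; first by move=> Nx; apply: Mx; right; exists k; rewrite ?rk.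
    by split => //; apply/eqP => x0; apply: Mx; left.
  move=> [k _]; case: ifPn => // ak [Bx Mx]; split => //; rewrite in_itv/= andbT.
  apply: (lt_trans ak); have [_ _ _ H] := NP (r k).
  by case: ((H x _).2 Bx) => // Nx; apply: Mx; right; exists k.
- move=> h; rewrite patchE; case: ifPn => // /set_mem Mh; apply: nu0.
  by apply/eqP => h0; apply: Mh; left.
- by move=> h Mh; rewrite patchE mem_set.
Qed.

End borel_version.

(** * Functions of class C^k *)

Section directional.
Context {R : realType} {V : normedModType R}.

(** Directional derivatives are derivatives of functions of one variable, which
    gives access to the chain rule and to the mean value theorem. *)
Lemma is_derive_lineP (f : V -> R) (x v : V) (t l : R) :
  is_derive t 1 (fun s => f (s *: v + x)) l <-> is_derive (t *: v + x) v f l.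
Proof.
have E : (fun h : R => h^-1 *: (((fun s => f (s *: v + x)) \o shift t) (h *: 1) -
      f (t *: v + x))) =
    (fun h : R => h^-1 *: ((f \o shift (t *: v + x)) (h *: v) - f (t *: v + x))).
  by apply/funext => h /=; rewrite [_%:A]mulr1 scalerDl addrA.
by split=> -[h1 h2]; split; move: h1 h2; rewrite /derivable /derive E.
Qed.

Lemma is_derive_comp (F : R -> R) (f : V -> R) (x v : V) (a b : R) :
  is_derive (f x) 1 F a -> is_derive x v f b -> is_derive x v (F \o f) (a * b).
Proof.
move=> dF df; have x0 : x = 0 *: v + x by rewrite scale0r add0r.
rewrite x0; apply/(is_derive_lineP (F \o f)).
apply: (is_derive1_comp (f := F) (g := fun s => f (s *: v + x))).
  by rewrite -x0.
by apply/is_derive_lineP; rewrite -x0.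
Qed.

End directional.

Section Ck.
Context {R : realType} {d : nat}.
Local Notation Rd := 'rV[R]_d.
Local Notation e i := (delta_mx ord0 i : Rd).
Implicit Types (f g : Rd -> R) (i : 'I_d).

(** Smoothness quantifies over lists of directions; peeling off the derivative
    taken first gives the induction that proves stability under products and
    compositions. *)
Fixpoint Ck (n : nat) f : Prop :=
  continuous f /\ (if n is m.+1 then
    (forall x i, derivable f x (e i)) /\ (forall i, Ck m (partial i f)) else True).

Lemma Ck_continuous n f : Ck n f -> continuous f. Proof. by case: n => [|n] []. Qed.

Lemma CkS n f : Ck n.+1 f -> Ck n f.
Proof.
elim: n f => [|n IHn] f [cf [df pf]]; first by split.
by split => //; split => // i; apply: IHn; exact: pf.
Qed.

Lemma smooth_partial f i : smooth f -> smooth (partial i f).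
Proof. by move=> sf s; have := sf (rcons s i); rewrite foldr_rcons. Qed.

Lemma smoothP f : smooth f <-> forall n, Ck n f.
Proof.
split=> [sf n|].
  elim: n f sf => [|n IHn] f sf; have [cf df] := sf [::]; first by split.
  split; first exact: cf.
  by split; [exact: df|move=> i; apply: IHn; exact: smooth_partial].
move=> + s; elim/last_ind: s f => [|s i IHs] f Cf /=.
  by split; [exact: Ck_continuous (Cf 0)|case: (Cf 1) => _ []].
by rewrite foldr_rcons; apply: IHs => n; case: (Cf n.+1) => _ [_]; exact.
Qed.

Lemma smooth_continuous f : smooth f -> continuous f.
Proof. by move=> /(_ [::])[]. Qed.

Lemma smooth_derivable f x i : smooth f -> derivable f x (e i).
Proof. by move=> /(_ [::])[_]; exact. Qed.

Lemma smooth_is_derive f x i : smooth f -> is_derive x (e i) f (partial i f x).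
Proof. by move=> sf; apply: derivableP; exact: smooth_derivable. Qed.

Lemma partialE f x i l : is_derive x (e i) f l -> partial i f x = l.
Proof. by case. Qed.

Lemma CkSP n f (D : 'I_d -> Rd -> R) : continuous f ->
  (forall x i, is_derive x (e i) f (D i x)) -> (forall i, Ck n (D i)) -> Ck n.+1 f.
Proof.
move=> cf df CD; split => //; split => [x i|i]; first by case: (df x i).
by rewrite (_ : partial i f = D i)//; apply/funext => x; exact: partialE.
Qed.

Lemma Ck_is_derive n f x i : Ck n.+1 f -> is_derive x (e i) f (partial i f x).
Proof. by case=> _ [df _]; exact: derivableP. Qed.

Lemma Ck_partial n f i : Ck n.+1 f -> Ck n (partial i f). Proof. by case=> _ [_]; exact. Qed.

Lemma Ck_cst n (c : R) : Ck n (fun=> c).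
Proof.
elim: n c => [|n IHn] c; first by split => //; exact: cst_continuous.
apply: (@CkSP n (fun=> c) (fun _ _ => 0)) => [|i]; last exact: IHn.
exact: cst_continuous.
Qed.

Lemma CkD n f g : Ck n f -> Ck n g -> Ck n (fun x => f x + g x).
Proof.
elim: n f g => [|n IHn] f g Cf Cg.
  split => // x; apply: continuousD; exact: (Ck_continuous (n := 0)).
have cf := Ck_continuous Cf; have cg := Ck_continuous Cg.
apply: (@CkSP _ _ (fun i x => partial i f x + partial i g x)).
- by move=> x; apply: continuousD; [exact: cf|exact: cg].
- move=> x i; have ? := Ck_is_derive x i Cf; have ? := Ck_is_derive x i Cg.
  exact: is_deriveD.
- by move=> i; apply: IHn; exact: Ck_partial.
Qed.

Lemma CkM n f g : Ck n f -> Ck n g -> Ck n (fun x => f x * g x).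
Proof.
elim: n f g => [|n IHn] f g Cf Cg.
  split => // x; apply: continuousM; exact: (Ck_continuous (n := 0)).
have cf := Ck_continuous Cf; have cg := Ck_continuous Cg.
apply: (@CkSP _ _ (fun i x => f x * partial i g x + g x * partial i f x)).
- by move=> x; apply: continuousM; [exact: cf|exact: cg].
- move=> x i; have ? := Ck_is_derive x i Cf; have ? := Ck_is_derive x i Cg.
  exact: is_deriveM.
- by move=> i; apply: CkD; apply: IHn; by [exact: CkS|exact: Ck_partial].
Qed.

Lemma Ck_coord n i : Ck n (fun x => x ord0 i).
Proof.
have cc : continuous (fun x : Rd => x ord0 i) by exact: coord_continuous.
case: n => [|n]; first by split.
apply: (@CkSP _ _ (fun j _ => (i == j)%:R)) => // [x j|j]; last exact: Ck_cst.
have x0 : x = 0 *: e j + x by rewrite scale0r add0r.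
rewrite x0; apply/(is_derive_lineP (fun x : Rd => x ord0 i)).
rewrite (_ : (fun s => _) = (id : R -> R) * cst (i == j)%:R + cst (x ord0 i)); last first.
  by apply/funext => s; rewrite !mxE eqxx.
by apply: is_derive_eq; rewrite scaler0 add0r addr0 /cst /= [_ *: _]mulr1.
Qed.

Lemma CkX n f k : Ck n f -> Ck n (fun x => f x ^+ k).
Proof.
move=> Cf; elim: k => [|k IHk].
  by under eq_fun do rewrite expr0; exact: Ck_cst.
by under eq_fun do rewrite exprS; exact: CkM.
Qed.

Lemma Ck_sum n (I : Type) (r : seq I) (F : I -> Rd -> R) :
  (forall k, Ck n (F k)) -> Ck n (fun x => \sum_(k <- r) F k x).
Proof.
move=> CF; elim: r => [|k r IHr].
  by under eq_fun do rewrite big_nil; exact: Ck_cst.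
by under eq_fun do rewrite big_cons; exact: CkD.
Qed.

Lemma CkV n f : (forall x, f x != 0) -> Ck n f -> Ck n (fun x => (f x)^-1).
Proof.
move=> f0; have cV : continuous f -> continuous (fun x => (f x)^-1).
  by move=> cf x; apply: continuousV => //; exact: cf.
elim: n => [|n IHn] Cf; first by split => //; exact/cV/(Ck_continuous Cf).
apply: (@CkSP _ _ (fun i x => (-1 * ((f x)^-1 * (f x)^-1)) * partial i f x)).
- exact/cV/(Ck_continuous Cf).
- move=> x i; have [df <-] := Ck_is_derive x i Cf; split; first exact: derivableV.
  by rewrite deriveV// mulN1r -expr2 exprVn.
- move=> i; apply: CkM; last exact: Ck_partial.
  by apply: CkM; [exact: Ck_cst|apply: CkM; apply: IHn; exact: CkS].
Qed.

Lemma Ck_shift n f (h : Rd) : Ck n f -> Ck n (fun x => f (x + h)).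
Proof.
have cS g : continuous g -> continuous (fun x : Rd => g (x + h)).
  move=> cg x; apply: (@continuous_comp _ _ _ (fun x : Rd => x + h) g); last exact: cg.
  by apply: (@continuousD _ _ _ id (cst h)); [exact: cvg_id|exact: cst_continuous].
elim: n f => [|n IHn] f Cf; first by split => //; exact/cS/(Ck_continuous Cf).
apply: (@CkSP _ _ (fun i x => partial i f (x + h))).
- exact/cS/(Ck_continuous Cf).
- move=> x i; have x0 : x = 0 *: e i + x by rewrite scale0r add0r.
  rewrite {1}x0; apply/(is_derive_lineP (fun x : Rd => f (x + h))).
  under eq_fun do rewrite -addrA.
  apply/is_derive_lineP; rewrite scale0r add0r; exact: (Ck_is_derive _ _ Cf).
- by move=> i; apply: IHn; exact: Ck_partial.
Qed.

Lemma partial_shift f (h : Rd) i x : smooth f ->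
  partial i (fun x : Rd => f (x + h)) x = partial i f (x + h).
Proof.
move=> sf; apply: partialE; have x0 : x = 0 *: e i + x by rewrite scale0r add0r.
rewrite {1}x0; apply/(is_derive_lineP (fun x : Rd => f (x + h))).
under eq_fun do rewrite -addrA.
by apply/is_derive_lineP; rewrite scale0r add0r; exact: smooth_is_derive.
Qed.

End Ck.

(** * The flat function exp(-1/y) *)

Section flat.
Context {R : realType}.

(** The derivatives of exp(-1/y), extended by 0 to the left of 0, are
    combinations of the functions y^-n exp(-1/y). *)
Definition flat (n : nat) (y : R) : R :=
  if 0 < y then y^-1 ^+ n * expR (- y^-1) else 0.

Lemma flat_le0 n y : y <= 0 -> flat n y = 0.
Proof. by rewrite /flat ltNge => ->. Qed.

Lemma flat_ge0 n y : 0 <= flat n y.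
Proof.
by rewrite /flat; case: ifPn => // y0; rewrite mulr_ge0 ?expR_ge0// exprn_ge0// invr_ge0 ltW.
Qed.

Lemma flat0_gt0 y : 0 < y -> 0 < flat 0 y.
Proof. by move=> y0; rewrite /flat y0 expr0 mul1r expR_gt0. Qed.

Lemma flat0_le1 y : flat 0 y <= 1.
Proof.
rewrite /flat; case: ifPn => // y0.
by rewrite expr0 mul1r expR_le1 oppr_le0 invr_ge0 ltW.
Qed.

(** The exponential dominates the power n + 2 of 1/y. *)
Lemma flat_le_sqr n y : flat n y <= n.+2`!%:R * y ^+ 2.
Proof.
rewrite /flat; case: ifPn => [y0|_]; last by rewrite mulr_ge0 ?sqr_ge0.
have z0 : 0 < y^-1 by rewrite invr_gt0.
have := expR_ge1Dxn n.+1 (ltW z0) => H.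
have {}H : y^-1 ^+ n.+2 <= n.+2`!%:R * expR y^-1.
  rewrite mulrC -ler_pdivrMr ?ltr0n ?fact_gt0//; apply: le_trans H.
  by rewrite lerDr.
rewrite expRN ler_pdivrMr ?expR_gt0//.
rewrite -(ler_pM2r (x := y^-1 ^+ 2)) ?exprn_gt0// -exprD addn2.
apply: (le_trans H).
rewrite [X in _ <= X](_ : _ = n.+2`!%:R * expR y^-1 * (y * y^-1) ^+ 2).
  by rewrite divff ?gt_eqF// expr1n mulr1.
by rewrite exprMn; ring.
Qed.

Lemma is_derive_flat n (y : R) :
  is_derive y 1 (flat n) (flat n.+2 y - n%:R * flat n.+1 y).
Proof.
have [y0|y0|->] := ltgtP y 0.
- rewrite !flat_le0 ?ltW// mulr0 subr0.
  apply: (@near_eq_is_derive _ _ _ (cst 0)).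
  near=> z; rewrite flat_le0//; apply: ltW; near: z.
  exact: lt_nbhsl.
- apply: (@near_eq_is_derive R R R (fun y : R => y^-1 ^+ n * expR (- y^-1))).
    near=> z; rewrite /flat ifT//; near: z; exact: lt_nbhsr.
  have yn0 : y != 0 by rewrite gt_eqF.
  have dV : is_derive y 1 (fun z : R => z^-1) (- y ^- 2 *: 1).
    exact: (is_deriveV (f := id)).
  have dG : is_derive (y^-1) 1 (horner ('X^n : {poly R}) * (expR \o -%R))
      (y^-1 ^+ n * (expR (- y^-1) * -1) + expR (- y^-1) * (n%:R * y^-1 ^+ n.-1)).
    apply: is_derive_eq; rewrite /GRing.scale/= hornerXn derivXn hornerMn hornerXn.
    by rewrite -mulr_natl.
  rewrite (_ : (fun z => _) = (horner ('X^n : {poly R}) * (expR \o -%R)) \o (fun z : R => z^-1)).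
    apply: is_derive_eq.
    rewrite /flat y0 /GRing.scale/= mulr1 -!exprVn.
    by case: n {dG} => [|n]; rewrite ?expr0 /= !exprS ?expr0; ring.
  by apply/funext => z; rewrite /= [in RHS]/GRing.mul/= hornerXn.
(* At 0 the difference quotient is at most (n + 2)! |h|. *)
- rewrite !flat_le0// mulr0 subr0.
  have F0 : (fun h : R => h^-1 *: ((flat n \o shift 0) (h *: 1) - flat n 0)) @ 0^' --> (0 : R).
    apply/cvgr0Pnorm_le => eps eps0; near=> h.
    have h0 : h != 0 by near: h; exact: nbhs_dnbhs_neq.
    rewrite /= addr0 (flat_le0 _ (lexx 0)) subr0 [_%:A]mulr1 normrZ normfV.
    rewrite ler_pdivrMl ?normr_gt0// ger0_norm ?flat_ge0//.
    apply: (le_trans (flat_le_sqr _ _)).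
    rewrite -[h ^+ 2]real_normK ?num_real// expr2 mulrA mulrC ler_wpM2l//.
    rewrite mulrC -ler_pdivlMr ?ltr0n ?fact_gt0//.
    near: h; apply: dnbhs0_le; by rewrite divr_gt0// ltr0n fact_gt0.
  by split; [apply/cvg_ex; exists 0|exact/cvg_lim].
Unshelve. all: by end_near. Qed.

End flat.

(** * Smooth functions of compact support *)

Section flat_comp.
Context {R : realType} {d : nat}.
Local Notation Rd := 'rV[R]_d.
Implicit Types f g : Rd -> R.

Lemma flat_continuous n : continuous (@flat R n).
Proof.
move=> y; apply/differentiable_continuous/derivable1_diffP.
by case: (is_derive_flat n y).
Qed.

Lemma Ck_flat n k g : Ck n g -> Ck n (fun x => flat k (g x)).
Proof.
have cF j (h : Rd -> R) : continuous h -> continuous (fun x : Rd => flat j (h x)).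
  move=> ch x; apply: (@continuous_comp _ _ _ h (flat j)); first exact: ch.
  exact: flat_continuous.
elim: n k g => [|n IHn] k g Cg; first by split => //; exact/cF/(Ck_continuous Cg).
apply: (@CkSP _ _ n _ (fun i x =>
  (flat k.+2 (g x) + - k%:R * flat k.+1 (g x)) * partial i g x)).
- exact/cF/(Ck_continuous Cg).
- move=> x i; rewrite mulNr; apply: (is_derive_comp (F := flat k)).
    exact: is_derive_flat.
  exact: (Ck_is_derive _ _ Cg).
- move=> i; apply: CkM; last exact: Ck_partial.
  have CgS := CkS Cg; apply: CkD; first exact: IHn.
  by apply: CkM; [exact: Ck_cst|exact: IHn].
Qed.

Definition sqnorm (x : Rd) : R := \sum_i x ord0 i ^+ 2.

Lemma Ck_sqnorm n : Ck n sqnorm.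
Proof. by apply: Ck_sum => i; apply: CkX; exact: Ck_coord. Qed.

Lemma sqnorm_ge0 x : 0 <= sqnorm x.
Proof. by apply: sumr_ge0 => i _; exact: sqr_ge0. Qed.

Lemma sqr_coord_le (x : Rd) i : x ord0 i ^+ 2 <= sqnorm x.
Proof.
rewrite /sqnorm (bigD1 i)//= lerDl; apply: sumr_ge0 => j _; exact: sqr_ge0.
Qed.

Lemma coord_le_norm (x : Rd) i : `|x ord0 i| <= `|x|.
Proof. by rewrite [X in _ <= X]mx_normrE; apply/bigmax_geP; right; exists (ord0, i). Qed.

Lemma norm_le_coord (x : Rd) (K : R) : 0 <= K -> (forall i, `|x ord0 i| <= K) -> `|x| <= K.
Proof.
move=> K0 xK; rewrite [X in X <= _]mx_normrE; apply/bigmax_leP; split => // -[i j] _ /=.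
by rewrite ord1.
Qed.

Lemma norm_le_sqnorm (x : Rd) : `|x| <= sqnorm x + 1.
Proof.
apply: norm_le_coord => [|i]; first by rewrite addr_ge0// sqnorm_ge0.
apply: le_trans (_ : x ord0 i ^+ 2 + 1 <= _); last by rewrite lerD2r sqr_coord_le.
by rewrite -[x ord0 i ^+ 2]real_normK ?num_real//; set a := `| _ |; nra.
Qed.

End flat_comp.

Section Cc_smooth.
Context {R : realType} {d : nat}.
Local Notation Rd := 'rV[R]_d.
Implicit Types f g : Rd -> R.

Lemma norm_le_closed (K : R) : closed [set x : Rd | `|x| <= K].
Proof.
apply: (@closed_comp _ _ (fun x : Rd => `|x|) [set y | y <= K]).
  by move=> x _; exact: norm_continuous.
exact: closed_le.
Qed.

Lemma Cc_smoothP f : Cc_smooth f <->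
  smooth f /\ exists K : R, forall x, K < `|x| -> f x = 0.
Proof.
split => [[sf cf]|[sf [K fK]]]; split => //.
  have [K0 [_ K0f]] : bounded_set (closure [set x | f x != 0]).
    exact: compact_bounded.
  have {K0 K0f}[K Kf] : exists K, closure [set x | f x != 0] `<=` [set x | `|x| <= K].
    by exists (K0 + 1); apply: K0f; rewrite ltrDl.
  exists K => x Kx; apply/eqP; apply: contraT => fx0.
  have /Kf/= : closure [set x | f x != 0] x by exact: subset_closure.
  by rewrite leNgt Kx.
apply: bounded_closed_compact; last exact: closed_closure.
have H : closure [set x | f x != 0] `<=` [set x : Rd | `|x| <= K].
  rewrite [X in _ `<=` X](closure_id _).1; last exact: norm_le_closed.
  apply: closure_subset => x /= fx0; rewrite leNgt; apply/negP => /fK fx.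
  by rewrite fx eqxx in fx0.
by exists K; split; [exact: num_real|move=> M /ltW KM x /H/= xK; exact: le_trans KM].
Qed.

Lemma Cc_smooth_smooth f : Cc_smooth f -> smooth f. Proof. by case. Qed.

Lemma Cc_smooth_bounded f : Cc_smooth f -> exists2 M : R, 0 <= M & forall x, `|f x| <= M.
Proof.
move=> [/smooth_continuous cf kf].
have [M0 [_ M0f]] : bounded_set (f @` closure [set x | f x != 0]).
  apply: compact_bounded; apply: continuous_compact => //.
  exact: continuous_subspaceT.
have {M0 M0f}[M fM] : exists M, f @` closure [set x | f x != 0] `<=` [set y | `|y| <= M].
  by exists (M0 + 1); apply: M0f; rewrite ltrDl.
exists `|M| => // x; have [->|fx0] := eqVneq (f x) 0; first by rewrite normr0.
apply: (le_trans _ (ler_norm M)); apply: fM; exists x => //.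
exact: subset_closure.
Qed.

Lemma Cc_smooth_partial f i : Cc_smooth f -> Cc_smooth (partial i f).
Proof.
move=> /Cc_smoothP[sf [K fK]]; apply/Cc_smoothP; split; first exact: smooth_partial.
exists K => x Kx; rewrite /partial (@near_eq_derive _ _ _ f (cst 0)) ?derive_cst//.
have oK : open [set x : Rd | K < `|x|].
  rewrite (_ : [set _ | _] = ~` [set x : Rd | `|x| <= K]).
    by apply: closed_openC; exact: norm_le_closed.
  by apply/seteqP; split => y /=; rewrite ltNge => /negP.
by have := oK x Kx; apply: filterS => y /fK.
Qed.

Lemma Cc_smoothM f g : smooth f -> Cc_smooth g -> Cc_smooth (fun x => f x * g x).
Proof.
move=> sf /Cc_smoothP[sg [K gK]]; apply/Cc_smoothP; split.
  by apply/smoothP => n; apply: CkM; move: n; exact/smoothP.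
by exists K => x /gK ->; rewrite mulr0.
Qed.

Lemma Cc_smooth_shift f (h : Rd) : Cc_smooth f -> Cc_smooth (fun x => f (x + h)).
Proof.
move=> /Cc_smoothP[sf [K gK]]; apply/Cc_smoothP; split.
  by apply/smoothP => n; apply: Ck_shift; move: n; exact/smoothP.
exists (K + `|h|) => x Kx; apply: gK.
have := ler_normB (x + h) h; rewrite addrK; lra.
Qed.

Lemma Cc_smooth_cst0 : Cc_smooth (fun _ : Rd => 0 : R).
Proof.
apply/Cc_smoothP; split; first by apply/smoothP => n; exact: Ck_cst.
by exists 0.
Qed.

Lemma smooth_measurable f : smooth f -> measurable_fun setT f.
Proof. by move=> sf; apply: continuous_measurable_rV; exact: smooth_continuous. Qed.

(** Supported in a ball, and increasing to 1 as r grows. *)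
Definition cutoff (r : R) (x : Rd) : R := flat 0 (r - sqnorm x).

Lemma Cc_smooth_cutoff r : Cc_smooth (cutoff r).
Proof.
apply/Cc_smoothP; split.
  apply/smoothP => n; apply: Ck_flat; apply: CkD; first exact: Ck_cst.
  under eq_fun do rewrite -mulN1r; apply: CkM; [exact: Ck_cst|exact: Ck_sqnorm].
exists (r + 1) => x rx; rewrite /cutoff flat_le0// subr_le0.
by have := norm_le_sqnorm x; lra.
Qed.

Lemma cutoff_ge0 r x : 0 <= cutoff r x. Proof. exact: flat_ge0. Qed.

Lemma cutoff_le1 r x : cutoff r x <= 1. Proof. exact: flat0_le1. Qed.

Lemma cutoff_gt0 r x : sqnorm x < r -> 0 < cutoff r x.
Proof. by move=> xr; apply: flat0_gt0; rewrite subr_gt0. Qed.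

Lemma cvg_cutoff x : cutoff n%:R x @[n --> \oo] --> (1 : R).
Proof.
apply/cvgrPdist_le => e e0; near=> n.
have n0 : sqnorm x + e^-1 <= n%:R by near: n; exact: nbhs_infty_ger.
have t0 : 0 < n%:R - sqnorm x by have : 0 < e^-1 by [rewrite invr_gt0]; lra.
rewrite ger0_norm ?subr_ge0 ?cutoff_le1// /cutoff /flat t0 expr0 mul1r.
have := expR_ge1Dx (- (n%:R - sqnorm x)^-1).
suff : (n%:R - sqnorm x)^-1 <= e by lra.
by rewrite -[leRHS]invrK lef_pV2 ?posrE ?invr_gt0//; lra.
Unshelve. all: by end_near. Qed.

End Cc_smooth.

(** * Local integrability, density of smooth functions *)

Section locint.
Context {R : realType} {d : nat}.
Local Notation Rd := 'rV[R]_d.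
Implicit Types (u w : Rd -> R) (phi : Rd -> R).

Definition normball (K : R) : set Rd := [set x | `|x| <= K].

Definition locint u := measurable_fun setT u /\
  forall K : R, leb.-integrable (normball K) (EFin \o u).

Lemma measurable_normball (K : R) : measurable (normball K).
Proof.
rewrite -[X in measurable X]setCK; apply: measurableC; apply: open_measurable_rV.
by apply: closed_openC; exact: norm_le_closed.
Qed.

Lemma leb_normball_lty (K : R) : (leb (normball K) < +oo)%E.
Proof.
pose A (i : 'I_d) : set (measurableTypeR R) := `[- K, K]%classic.
pose B : set Rd := [set x | forall i, A i (x ord0 i)].
have mA i : measurable (A i) by exact: measurable_itv.
have mB : measurable B by exact: (measurable_box (A := A)).
apply: (@le_lt_trans _ _ (leb B)).
  apply: le_measure; rewrite ?inE//; first exact: measurable_normball.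
  move=> x /= xK i.
  rewrite /A /= in_itv/= -ler_norml.
  exact: le_trans (coord_le_norm x i) xK.
rewrite -ge0_fin_numE// leb_box//; elim/big_ind: _ => // [a b|i _]; first exact: fin_numM.
by rewrite /A lebesgue_measure_itv/=; case: ifP => _; rewrite ?fin_numD.
Qed.


Lemma Lnorm_powRE (p : R) u : p != 0 ->
  (Lnorm leb p%:E (EFin \o u) `^ p = \int[leb]_x (`|u x| `^ p)%:E)%E.
Proof. by move=> p0; rewrite powR_Lnorm. Qed.

Lemma Lfun_powRP (p : R) u : 1 <= p -> u \in Lfun leb p%:E <->
  measurable_fun setT u /\ (\int[leb]_x (`|u x| `^ p)%:E < +oo)%E.
Proof.
move=> p1; have p0 : p != 0 by rewrite gt_eqF// (lt_le_trans _ p1).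
split => [uL|[mu uoo]].
  split; first by move: uL => /sub_Lfun_mfun; rewrite inE.
  by rewrite -Lnorm_powRE// poweR_lty//; move: uL => /sub_Lfun_finLfun; rewrite inE.
rewrite inE; apply/andP; split; first by rewrite inE.
by rewrite inE/= /finite_norm (@lty_poweRy _ _ p)// Lnorm_powRE.
Qed.

Lemma integrable_boundedM (w phi : Rd -> R) (D : set Rd) (M : R) : measurable D ->
  leb.-integrable D (EFin \o w) -> measurable_fun D phi ->
  (forall x, D x -> `|phi x| <= M) -> leb.-integrable D (fun x => (w x * phi x)%:E).
Proof.
move=> mD iw mphi phiM.
apply: (@le_integrable _ _ _ _ _ mD _ (fun x => M%:E * (EFin \o w) x)%E).
- apply/measurable_EFinP; apply: measurable_funM => //.
  by apply/measurable_EFinP; exact: measurable_int iw.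
- move=> x Dx; rewrite /= lee_fin !normrM mulrC ler_wpM2r//.
  by rewrite (le_trans (phiM x Dx))// ler_norm.
- exact: integrableZl.
Qed.

Lemma integrable_locintM u phi : locint u -> Cc_smooth phi ->
  leb.-integrable setT (fun x => (u x * phi x)%:E).
Proof.
move=> [mu iu] Cphi; have [M _ phiM] := Cc_smooth_bounded Cphi.
have mphi := smooth_measurable (Cc_smooth_smooth Cphi).
have /Cc_smoothP[_ [K phiK]] := Cphi; have mB := measurable_normball K.
have := integrable_boundedM mB (iu K) (measurable_funTS mphi) (fun x _ => phiM x).
move=> /(integrable_mkcond _ mB).
suff -> : (fun x => (u x * phi x)%:E) \_ (normball K) = (fun x => (u x * phi x)%:E) by [].
apply/funext => x; rewrite patchE; case: ifPn => // /negP xK.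
rewrite phiK ?mulr0// ltNge; apply/negP => xK'; apply: xK.
by rewrite inE.
Qed.

Lemma Lfun_locint (p : R) u : 1 <= p -> u \in Lfun leb p%:E -> locint u.
Proof.
move=> p1 /(Lfun_powRP _ p1)[mu uoo]; split => // K.
have mB := measurable_normball K.
have mup : measurable_fun setT (fun x => `|u x| `^ p).
  by apply: (measurableT_comp (measurable_powR p)); exact: measurableT_comp.
apply/integrableP; split; first exact/measurable_EFinP/measurable_funTS.
apply: (@le_lt_trans _ _ (\int[leb]_(x in normball K) (1 + (`|u x| `^ p)%:E))%E).
  apply: ge0_le_integral => //.
  - by apply: measurableT_comp => //; exact/measurable_EFinP/measurable_funTS.
  - apply: emeasurable_funD => //; exact/measurable_EFinP/measurable_funTS.
  move=> x _; rewrite /= -EFinD lee_fin.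
  (* |u| <= 1 + |u|^p, according to whether |u| <= 1. *)
  have [u1|u1] := leP `|u x| 1; first by rewrite (le_trans u1)// lerDl powR_ge0.
  by rewrite -[leLHS]powRr1// (le_trans (ler_powR (ltW u1) p1))// lerDr.
rewrite ge0_integralD//; last exact/measurable_EFinP/measurable_funTS.
rewrite integral_cst// mul1e lte_add_pinfty//; first exact: leb_normball_lty.
by apply: le_lt_trans uoo; apply: ge0_subset_integral => //; exact/measurable_EFinP.
Qed.

Lemma locint_shift (u : Rd -> R) (h : Rd) : locint u -> locint (fun x => u (x + h)).
Proof.
move=> [mu iu]; split => [|K]; first exact: (measurableT_comp mu (measurable_shift h)).
have mB := measurable_normball.
have := integrable_shift h ((integrable_mkcond _ (mB (K + `|h|))).1 (iu (K + `|h|))).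
move=> /(integrableS measurableT (mB K) (@subsetT _ _)).
apply: eq_integrable => // x; rewrite inE /normball/= => xK.
by rewrite patchE mem_set// /normball/=; have := ler_normD x h; lra.
Qed.

Lemma locintB (u v : Rd -> R) : locint u -> locint v -> locint (fun x => u x - v x).
Proof.
move=> [mu iu] [mv iv]; split => [|K]; first exact: measurable_funB.
have mB := measurable_normball K.
by have := integrableB mB (iu K) (iv K); apply: eq_integrable.
Qed.

End locint.

Section density.
Context {R : realType} {d : nat}.
Local Notation Rd := 'rV[R]_d.
Variable w : Rd -> R.
Hypothesis iw : leb.-integrable setT (EFin \o w).

Let mw : measurable_fun setT w.
Proof. by apply/measurable_EFinP; exact: measurable_int iw. Qed.

Definition unit_smooth (phi : Rd -> R) := smooth phi /\ forall x, 0 <= phi x <= 1.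

(** Approximation in L^1 of the finite measure |w| dx. The values in [0, 1] make
    the class of approximable sets stable under complements and unions. *)
Definition approximable (A : set Rd) := forall e : R, 0 < e -> exists phi,
  unit_smooth phi /\ (\int[leb]_x (`|w x| * `|phi x - \1_A x|)%:E <= e%:E)%E.

Lemma weighted_cvg (f_ : nat -> Rd -> R) (f : Rd -> R) :
  (forall n, measurable_fun setT (f_ n)) -> (forall n x, 0 <= f_ n x <= 1) ->
  (forall x, 0 <= f x <= 1) ->
  (forall x, f_ n x @[n --> \oo] --> f x) ->
  forall e : R, 0 < e -> exists n,
  (\int[leb]_x (`|w x| * `|f_ n x - f x|)%:E <= e%:E)%E.
Proof.
move=> mf_ f_01 f01 f_f e e0.
have mf : measurable_fun setT f by apply: measurable_fun_cvg mf_ _ => x _; exact: f_f.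
have mF n : measurable_fun setT (fun x => (`|w x| * `|f_ n x - f x|)%:E).
  apply/measurable_EFinP/measurable_funM; first exact: measurableT_comp.
  by apply: measurableT_comp => //; exact: measurable_funB.
have := @dominated_cvg _ _ _ leb _ measurableT
  (fun n x => (`|w x| * `|f_ n x - f x|)%:E) (cst 0%E) (fun x => `|(w x)%:E|%E) mF.
rewrite integral0 => /(_ _ _ _ _)/fine_cvgP; case.
- move=> x _; apply: cvg_EFin; first exact: nearW.
  rewrite [X in _ --> X](_ : 0 = `|w x| * `|f x - f x|); last by rewrite subrr normr0 mulr0.
  by apply: cvgMr; apply: cvg_norm; apply: cvgB => //; exact: cvg_cst.
- by [].
- by apply: integrable_abse.
- move=> n x _; rewrite /= lee_fin normrM !normr_id ler_piMr// ler_norml.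
  by have := f_01 n x; have := f01 x; lra.
move=> fin /cvgrPdist_le/(_ _ e0) H.
near \oo => n; exists n.
have Hn : `|0 - fine (\int[leb]_x (`|w x| * `|f_ n x - f x|)%:E)%E| <= e by near: n.
have Fn : (\int[leb]_x (`|w x| * `|f_ n x - f x|)%:E)%E \is a fin_num by near: n.
rewrite -(fineK Fn) lee_fin; move: Hn; rewrite sub0r normrN; apply: le_trans.
exact: ler_norm.
Unshelve. all: by end_near. Qed.

Lemma measurable_weight (phi psi : Rd -> R) : measurable_fun setT phi ->
  measurable_fun setT psi -> measurable_fun setT (fun x => (`|w x| * `|phi x - psi x|)%:E).
Proof.
move=> mphi mpsi; apply/measurable_EFinP/measurable_funM; first exact: measurableT_comp.
by apply: measurableT_comp => //; exact: measurable_funB.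
Qed.

Lemma approximable0 : approximable set0.
Proof.
move=> e e0; exists (fun=> 0); split.
  by split => [|x]; [apply/smoothP => n; exact: Ck_cst|rewrite lexx ler01].
under eq_integral do rewrite indicE in_set0 subr0 normr0 mulr0.
by rewrite integral0 lee_fin ltW.
Qed.

Lemma approximableC A : approximable A -> approximable (~` A).
Proof.
move=> aA e /aA[phi [[sphi phi01] phiA]]; exists (fun x => 1 + -1 * phi x); split.
  split => [|x]; last by have := phi01 x; lra.
  apply/smoothP => n; apply: CkD; first exact: Ck_cst.
  by apply: CkM; [exact: Ck_cst|move: n; exact/smoothP].
apply: le_trans phiA; rewrite le_eqVlt; apply/orP; left; apply/eqP.
apply: eq_integral => x _; congr (_ * _)%:E; rewrite -normrN; congr `|_|.
by rewrite !indicE in_setC; case: (x \in A) => /=; ring.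
Qed.

(** 1 - (1 - phi)(1 - psi) approximates the indicator of a union. *)
Lemma approximableU A B : measurable A -> measurable B ->
  approximable A -> approximable B -> approximable (A `|` B).
Proof.
move=> mA mB aA aB e e0; have e20 : 0 < e / 2 by rewrite divr_gt0.
have [phi [[sphi phi01] phiA]] := aA _ e20.
have [psi [[spsi psi01] psiB]] := aB _ e20.
exists (fun x => phi x + psi x * (1 + -1 * phi x)); split.
  split => [|x]; last by have := phi01 x; have := psi01 x; nra.
  apply/smoothP => n; apply: CkD; first by move: n; exact/smoothP.
  apply: CkM; first by move: n; exact/smoothP.
  apply: CkD; first exact: Ck_cst.
  by apply: CkM; [exact: Ck_cst|move: n; exact/smoothP].
have mphi := smooth_measurable sphi; have mpsi := smooth_measurable spsi.
rewrite (splitr e) EFinD; apply: le_trans (leeD phiA psiB).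
rewrite -ge0_integralD//; [|exact: measurable_weight..].
apply: ge0_le_integral => //.
- apply: measurable_weight; last exact/measurable_indic/measurableU.
  apply: measurable_funD => //; apply: measurable_funM => //.
  by apply: measurable_funD => //; exact: measurable_funM.
- by apply: emeasurable_funD; exact: measurable_weight.
move=> x _; rewrite -EFinD lee_fin -mulrDr ler_wpM2l// !indicE in_setU.
have /andP[p0 p1] := phi01 x; have /andP[q0 q1] := psi01 x.
case: (x \in A); case: (x \in B) => /=; rewrite ?subr0.
- rewrite [`|phi x - 1|]ler0_norm ?[`|psi x - 1|]ler0_norm; rewrite ?ler_norml; nra.
- rewrite [`|phi x - 1|]ler0_norm ?[`|psi x|]ger0_norm; rewrite ?ler_norml; nra.
- rewrite [`|phi x|]ger0_norm ?[`|psi x - 1|]ler0_norm; rewrite ?ler_norml; nra.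
- rewrite [`|phi x|]ger0_norm ?[`|psi x|]ger0_norm; rewrite ?ler_norml; nra.
Qed.

Lemma approximable_lim (f_ : nat -> Rd -> R) A : measurable A ->
  (forall n, measurable_fun setT (f_ n)) -> (forall n x, 0 <= f_ n x <= 1) ->
  (forall x, f_ n x @[n --> \oo] --> (\1_A x : R)) ->
  (forall n (e : R), 0 < e -> exists phi, unit_smooth phi /\
     (\int[leb]_x (`|w x| * `|phi x - f_ n x|)%:E <= e%:E)%E) ->
  approximable A.
Proof.
move=> mA mf f01 fA af e e0; have e20 : 0 < e / 2 by rewrite divr_gt0.
have A01 x : 0 <= (\1_A x : R) <= 1 by rewrite indicE; case: (x \in A); rewrite /= lexx ler01.
have [n fnA] := weighted_cvg mf f01 A01 fA e20.
have [phi [uphi phif]] := af n _ e20.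
exists phi; split => //; have mphi := smooth_measurable uphi.1.
have mIA : measurable_fun setT (\1_A : Rd -> R) by exact: measurable_indic.
rewrite (splitr e) EFinD; apply: le_trans (leeD phif fnA).
rewrite -ge0_integralD//; [|exact: measurable_weight..].
apply: ge0_le_integral => //; first exact: measurable_weight.
- by apply: emeasurable_funD; exact: measurable_weight.
move=> x _; rewrite -EFinD lee_fin -mulrDr ler_wpM2l//.
exact: ler_distD.
Qed.

(** If 0 <= f <= 1, the smooth functions 1 - (1 - f)^n converge to the indicator
    of f > 0. *)
Lemma approximable_halfspace (i : 'I_d) (a : R) : approximable [set x | a < x ord0 i].
Proof.
pose f_ n (x : Rd) : R := 1 + -1 * (1 + -1 * flat 0 (x ord0 i + - a)) ^+ n.
have f01 (x : Rd) : 0 <= (1 + -1 * flat 0 (x ord0 i + - a) : R) <= 1.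
  by have := flat_ge0 0 (x ord0 i + - a); have := flat0_le1 (x ord0 i + - a); lra.
have uf n : unit_smooth (f_ n).
  split => [|x].
    apply/smoothP => k; apply: CkD; first exact: Ck_cst.
    apply: CkM; [exact: Ck_cst|apply: CkX]; apply: CkD; first exact: Ck_cst.
    apply: CkM; [exact: Ck_cst|apply: Ck_flat].
    by apply: CkD; [exact: Ck_coord|exact: Ck_cst].
  have /andP[h0 h1] := f01 x.
  have := exprn_ge0 n h0; have := exprn_ile1 n h0 h1; rewrite /f_; lra.
apply: (@approximable_lim f_ [set x : Rd | a < x ord0 i]).
- rewrite (_ : mkset _ = (fun x : Rd => x ord0 i) @^-1` `]a, +oo[%classic).
    by rewrite -[X in measurable X]setTI; exact: measurable_coord.
  by apply/seteqP; split => x /=; rewrite in_itv/= andbT.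
- by move=> n; apply: smooth_measurable; case: (uf n).
- by move=> n; case: (uf n).
- move=> x; rewrite /f_ indicE; have [xa|xa] := ltP a (x ord0 i).
    rewrite mem_set//= [X in _ --> X](_ : 1 = 1 + -1 * 0); last by ring.
    apply: cvgD; first exact: cvg_cst; apply: cvgM; first exact: cvg_cst.
    apply: cvg_expr; have := f01 x; have := @flat0_gt0 R (x ord0 i + - a).
    rewrite subr_gt0 => /(_ xa) h1 /andP[h2 h3]; rewrite ger0_norm//; lra.
  rewrite memNset//=; last by move=> /=; rewrite ltNge xa.
  rewrite flat_le0 ?subr_le0//; under eq_fun do rewrite mulr0 addr0 expr1n mulr1 subrr.
  exact: cvg_cst.
- move=> n e e0; exists (f_ n); split => //.
  under eq_integral do rewrite subrr normr0 mulr0.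
  by rewrite integral0 lee_fin ltW.
Qed.

Lemma approximable_bigcup (F : nat -> set Rd) :
  (forall k, measurable (F k) /\ approximable (F k)) -> approximable (\bigcup_k F k).
Proof.
move=> aF; pose G n := \big[setU/set0]_(k < n) F k.
have mF k : measurable (F k) by case: (aF k).
have mG n : measurable (G n) by apply: bigsetU_measurable.
have aG n : approximable (G n).
  rewrite /G; elim: n => [|n IHn]; first by rewrite big_ord0; exact: approximable0.
  rewrite big_ord_recr/=; apply: approximableU => //; last by case: (aF n).
  exact: mG.
apply: (@approximable_lim (fun n => \1_(G n))) => //.
- exact: bigcupT_measurable.
- by move=> n x; rewrite indicE; case: (x \in G n); rewrite /= lexx ler01.
- move=> x; have [[k _ Fkx]|nFx] := pselect ((\bigcup_k F k) x).
    rewrite indicE mem_set; last by exists k.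
    apply: cvg_near_cst; near=> n; rewrite indicE mem_set//.
    rewrite /G -bigcup_mkord; exists k => //=; near: n; exact: nbhs_infty_gt.
  rewrite indicE memNset//; apply: cvg_near_cst; near=> n; rewrite indicE memNset//.
  by rewrite /G -bigcup_mkord => -[k _ Fkx]; apply: nFx; exists k.
Unshelve. all: by end_near. Qed.

(** The approximable sets form a sigma-algebra containing the half-spaces. *)
Lemma measurable_approximable A : measurable A -> approximable A.
Proof.
pose M : set (set Rd) := [set A | measurable A /\ approximable A].
have MC B : M B -> M (~` B).
  by move=> [mB aB]; split; [exact: measurableC|exact: approximableC].
have MU (F : (set Rd)^nat) : (forall k, M (F k)) -> M (\bigcup_k F k).
  move=> MF; have mF k : measurable (F k) by case: (MF k).
  have aF k : approximable (F k) by case: (MF k).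
  have mU : measurable (\bigcup_k F k) by exact: bigcupT_measurable.
  by split => //; apply: approximable_bigcup => k; split.
suff /(_ A) H : @measurable _ Rd `<=` M by move=> /H[].
apply: smallest_sub.
  split => [|B MB|F MF]; first by split; [exact: measurable0|exact: approximable0].
    by rewrite setTD; exact: MC.
  exact: MU.
rewrite -bigcup_seq/= => B [i _] [C mC <-]; rewrite /= setTI.
(* For a fixed coordinate, the sets of reals with an approximable preimage form a
   sigma-algebra containing the rays. *)
pose N : set (set R) := [set C | M ((fun x : Rd => x ord0 i) @^-1` C)].
suff : @measurable _ R `<=` N by exact.
rewrite (_ : @measurable _ R = <<s @RGenOInfty.G R >>); last exact: RGenOInfty.measurableE.
apply: smallest_sub.
  split => [|D ND|F NF].
  - by rewrite /N/= preimage_set0; split; [exact: measurable0|exact: approximable0].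
  - by rewrite /N/= setTD preimage_setC; exact: MC.
  - by rewrite /N/= preimage_bigcup; exact: MU.
move=> _ [a ->]; rewrite /N/=; split.
  by rewrite -[X in measurable X]setTI; exact: measurable_coord.
rewrite (_ : _ @^-1` _ = [set x : Rd | a < x ord0 i]); first exact: approximable_halfspace.
by apply/seteqP; split => x /=; rewrite in_itv/= andbT.
Qed.

End density.

(** * Duality with smooth functions of compact support *)

Section duality.
Context {R : realType} {d : nat}.
Local Notation Rd := 'rV[R]_d.

Lemma sumr_weightE (w a : Rd -> R) : leb.-integrable setT (EFin \o w) ->
  leb.-integrable setT (EFin \o a) ->
  leb.-integrable setT (EFin \o (fun x => `|w x| + a x)).
Proof.
move=> iw ia; have := integrableD measurableT (integrable_abse iw) ia.
by apply: eq_integrable.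
Qed.

Lemma excess_pointwise (w a p q : R) : 0 <= a -> 0 <= p <= 1 -> 0 <= q <= 1 ->
  Num.max (`|w| - a) 0 <= w * (p - q) - a * `|p - q| +
    (`|w| + a) * (`|p - (0 < w - a)%R%:R| + `|q - (w + a < 0)%R%:R|).
Proof.
move=> a0 /andP[p0 p1] /andP[q0 q1].
have pq : `|p - q| <= p + q by rewrite ler_norml; apply/andP; split; lra.
have pq1 : `|p - q| <= 1 by rewrite ler_norml; apply/andP; split; lra.
have pqm : 0 <= a * (1 - `|p - q|) by rewrite mulr_ge0// subr_ge0.
have [wa|wa] := ltP 0 (w - a); have [wa'|wa'] := ltP (w + a) 0 => /=.
- lra.
- rewrite subr0 (ger0_norm q0) (ler0_norm (_ : p - 1 <= 0)); last by lra.
  rewrite (ger0_norm (_ : 0 <= w)); last by lra.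
  rewrite (max_idPl _); last by lra.
  have : 0 <= a * (1 - (p - q)) by rewrite mulr_ge0//; lra.
  move: pqm; set r := `|p - q|; lra.
- rewrite subr0 (ger0_norm p0) (ler0_norm (_ : q - 1 <= 0)); last by lra.
  rewrite (ler0_norm (_ : w <= 0)); last by lra.
  rewrite (max_idPl _); last by lra.
  have : 0 <= a * (1 + (p - q)) by rewrite mulr_ge0//; lra.
  move: pqm; set r := `|p - q|; lra.
- rewrite !subr0 (ger0_norm q0) (ger0_norm p0).
  have wa3 : `|w| <= a by rewrite ler_norml; apply/andP; split; lra.
  rewrite (max_idPr _); last by rewrite subr_le0.
  have h1 : - (`|w| * (p + q)) <= w * (p - q).
    rewrite lerNl; apply: (le_trans (ler_norm _)); rewrite normrN normrM ler_wpM2l//.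
  have : a * `|p - q| <= a * (p + q) by rewrite ler_wpM2l.
  move: h1; set r := `|p - q|; set v := `|w|; lra.
Qed.

(** Tested against the indicators of w > a and of w < - a, with opposite signs,
    the bound is the conclusion; these indicators are limits of smooth
    functions in the space L^1 of weight |w| + a. *)
Lemma integral_excess_le (w a : Rd -> R) (C : R) :
  leb.-integrable setT (EFin \o w) -> leb.-integrable setT (EFin \o a) ->
  (forall x, 0 <= a x) ->
  (forall phi, Cc_smooth phi -> (forall x, `|phi x| <= 1) ->
    (\int[leb]_x (w x * phi x - a x * `|phi x|)%:E <= C%:E)%E) ->
  (\int[leb]_x (Num.max (`|w x| - a x) 0)%:E <= C%:E)%E.
Proof.
move=> iw ia a0 H.
have mw : measurable_fun setT w by apply/measurable_EFinP; exact: measurable_int iw.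
have ma : measurable_fun setT a by apply/measurable_EFinP; exact: measurable_int ia.
have ipair (f : Rd -> R) : measurable_fun setT f -> (forall x, `|f x| <= 1) ->
    leb.-integrable setT (fun x => (w x * f x - a x * `|f x|)%:E).
  move=> mf f1; have f1' x : setT x -> `|f x| <= 1 by [].
  have := integrableB measurableT (integrable_boundedM measurableT iw mf f1')
    (@integrable_boundedM _ _ _ (fun x => `|f x|) _ 1 measurableT ia _ _).
  apply => //; first exact: measurableT_comp.
  by move=> x _; rewrite normr_id.
(* Cutting off extends the bound to test functions without compact support. *)
have Hs (f : Rd -> R) : smooth f -> (forall x, `|f x| <= 1) ->
    (\int[leb]_x (w x * f x - a x * `|f x|)%:E <= C%:E)%E.
  move=> sf f1.
  pose z n x := f x * cutoff n%:R x.
  have z1 n x : `|z n x| <= 1.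
    rewrite /z normrM mulr_ile1// ger0_norm; [exact: cutoff_le1|exact: cutoff_ge0].
  have mz n : measurable_fun setT (z n).
    apply: measurable_funM; first exact: smooth_measurable.
    by apply: smooth_measurable; apply: Cc_smooth_smooth; exact: Cc_smooth_cutoff.
  have zf x : z n x @[n --> \oo] --> f x.
    rewrite -[X in _ --> X]mulr1; apply: cvgM; [exact: cvg_cst|exact: cvg_cutoff].
  have iW := sumr_weightE iw ia.
  have D : (\int[leb]_x (w x * z n x - a x * `|z n x|)%:E)%E @[n --> \oo] -->
      (\int[leb]_x (w x * f x - a x * `|f x|)%:E)%E.
    apply: (@dominated_cvg _ _ _ leb _ measurableT _ _ (EFin \o (fun x => `|w x| + a x))) => //.
    - move=> n; exact: measurable_int (ipair _ (mz n) (z1 n)).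
    - move=> x _; apply: cvg_EFin; first exact: nearW.
      apply: cvgB; first by apply: cvgMr; exact: zf.
      by apply: cvgMr; apply: cvg_norm; exact: zf.
    - move=> n x _; rewrite /= lee_fin.
      apply: (le_trans (ler_normB _ _)); apply: lerD.
        by rewrite normrM ler_piMr.
      by rewrite normrM normr_id (ger0_norm (a0 x)) ler_piMr.
  apply: (closed_cvg (fun y => (y <= C%:E)%E) _ _ _ D).
    exact: closed_ereal_ge_ereal.
  apply: nearW => n; apply: H; last exact: z1.
  exact: (Cc_smoothM sf (Cc_smooth_cutoff _)).
pose W x := `|w x| + a x.
have iW : leb.-integrable setT (EFin \o W) by exact: sumr_weightE.
have mW : measurable_fun setT W by apply/measurable_EFinP; exact: measurable_int iW.
have W0 x : 0 <= W x by rewrite addr_ge0.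
(* f1 - f2 is the test function, with f1 and f2 close to the indicators of E1 and E2. *)
pose E1 : set Rd := (fun x => w x - a x) @^-1` `]0, +oo[%classic.
pose E2 : set Rd := (fun x => w x + a x) @^-1` `]-oo, 0[%classic.
have mE1 : measurable E1.
  by rewrite -[X in measurable X]setTI; apply: measurable_funB.
have mE2 : measurable E2.
  by rewrite -[X in measurable X]setTI; apply: measurable_funD.
apply/lee_addgt0Pr => e e0; have e20 : 0 < e / 2 by rewrite divr_gt0.
have [f1 [[sf1 f1_01] Hf1]] := measurable_approximable iW mE1 e20.
have [f2 [[sf2 f2_01] Hf2]] := measurable_approximable iW mE2 e20.
pose f x := f1 x - f2 x.
have sf : smooth f.
  apply/smoothP => n; apply: CkD; first by move: n; exact/smoothP.
  under eq_fun do rewrite -mulN1r.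
  by apply: CkM; [exact: Ck_cst|move: n; exact/smoothP].
have fle1 x : `|f x| <= 1.
  by have := f1_01 x; have := f2_01 x; rewrite ler_norml /f; lra.
have := Hs f sf fle1; have := ipair f (smooth_measurable sf) fle1.
move=> if_ Hf.
have iWf g (A : set Rd) : smooth g -> (forall x, 0 <= g x <= 1) -> measurable A ->
    leb.-integrable setT (fun x => (`|W x| * `|g x - \1_A x|)%:E).
  move=> sg g01 mA; apply: (@integrable_boundedM _ _ _ _ _ 1) => //.
  - by have := integrable_abse iW; apply: eq_integrable.
  - apply: measurableT_comp => //; apply: measurable_funB; first exact: smooth_measurable.
    exact: measurable_indic.
  - move=> x _; rewrite normr_id indicE; have := g01 x.
    by case: (x \in A) => /=; rewrite ler_norml; lra.
apply: (@le_trans _ _ (\int[leb]_x ((w x * f x - a x * `|f x|)%:E +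
    ((`|W x| * `|f1 x - \1_E1 x|)%:E + (`|W x| * `|f2 x - \1_E2 x|)%:E)))%E); last first.
  rewrite integralD//=; last by apply: integrableD => //; exact: iWf.
  rewrite integralD//=; [|exact: iWf..].
  by rewrite (splitr e) EFinD leeD// leeD.
apply: le_integral => //.
- apply: (@le_integrable _ _ _ _ _ measurableT _ (EFin \o W)) => //.
    apply/measurable_EFinP; apply: measurable_maxr => //.
    by apply: measurable_funB => //; exact: measurableT_comp.
  move=> x _; rewrite /= lee_fin (ger0_norm (W0 x)) ger0_norm ?le_max ?lexx ?orbT//.
  rewrite ge_max W0 andbT /W; have := a0 x; lra.
- by apply: integrableD => //; apply: integrableD => //; exact: iWf.
move=> x _; rewrite -!EFinD lee_fin (ger0_norm (W0 x)) -mulrDr !indicE.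
have E1P : (x \in E1) = (0 < w x - a x).
  by apply/idP/idP; rewrite inE /E1/= in_itv/= andbT.
have E2P : (x \in E2) = (w x + a x < 0).
  by apply/idP/idP; rewrite inE /E2/= in_itv/=.
rewrite E1P E2P /f /W; have /andP[p0 p1] := f1_01 x; have /andP[q0 q1] := f2_01 x.
by apply: excess_pointwise; rewrite ?p0 ?q0 ?a0.
Qed.

End duality.

(** * Integration by parts *)

Section parts.
Context {R : realType} {d : nat}.
Local Notation Rd := 'rV[R]_d.
Local Notation e i := (delta_mx ord0 i : Rd).
Implicit Types (f g : Rd -> R) (i : 'I_d).

Lemma is_derive_smooth_line f i x (t : R) : smooth f ->
  is_derive t 1 (fun s => f (s *: e i + x)) (partial i f (t *: e i + x)).
Proof. by move=> sf; apply/is_derive_lineP; exact: smooth_is_derive. Qed.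

Lemma smooth_increment_le f i (M t : R) x : smooth f ->
  (forall y, `|partial i f y| <= M) -> 0 <= t ->
  `|f (t *: e i + x) - f x| <= M * t.
Proof.
move=> sf fM t0.
have [||s _] := @MVT_segment R (fun s => f (s *: e i + x))
  (fun s => partial i f (s *: e i + x)) 0 t t0.
- by move=> s _; exact: is_derive_smooth_line.
- apply: continuous_subspaceT => s; apply/differentiable_continuous/derivable1_diffP.
  by case: (is_derive_smooth_line i x s sf).
by rewrite scale0r add0r subr0 => ->; rewrite normrM (ger0_norm t0) ler_wpM2r.
Qed.

Lemma locint_cst (c : R) : locint (fun _ : Rd => c).
Proof.
split=> [|K]; first exact: measurable_cst.
have mB := @measurable_normball R d K; apply/integrableP; split.
  by apply/measurable_EFinP; exact: measurable_cst.
under eq_integral do rewrite /=.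
rewrite integral_cst// lte_mul_pinfty ?lee_fin//; exact: leb_normball_lty.
Qed.

Lemma integrable_Cc f : Cc_smooth f -> leb.-integrable setT (EFin \o f).
Proof.
move=> Cf; have := integrable_locintM (locint_cst 1) Cf.
by apply: eq_integrable => // x _; rewrite /= mul1r.
Qed.

(** The difference quotients of f have integral 0 by translation invariance, and
    they converge boundedly to the derivative on a common bounded set. *)
Lemma integral_partial0 f i : Cc_smooth f -> (\int[leb]_x (partial i f x)%:E = 0)%E.
Proof.
move=> Cf; have sf := Cc_smooth_smooth Cf; have mf := smooth_measurable sf.
have [M M0 fM] := Cc_smooth_bounded (Cc_smooth_partial i Cf).
have /Cc_smoothP[_ [K fK]] := Cf.
pose t n : R := n.+1%:R^-1.
have t0 n : 0 < t n by rewrite invr_gt0.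
have t1 n : t n <= 1 by rewrite invf_le1// ler1n.
pose q n x := (t n)^-1 * (f (t n *: e i + x) - f x).
have tcvg : t n @[n --> \oo] --> 0^'.
  move=> P /= [eps eps0 epsP]; have := near_infty_natSinv_lt (PosNum eps0).
  apply: filterS => n /= tn; apply: epsP; last by rewrite gt_eqF// t0.
  by rewrite /= sub0r normrN gtr0_norm ?t0.
have qcvg x : q n x @[n --> \oo] --> partial i f x.
  have [df dE] := smooth_is_derive x i sf.
  rewrite -dE; exact: (@cvg_comp _ _ _ t (fun h => h^-1 *: ((f \o shift x) (h *: e i) - f x)) _ _ _ tcvg df).
have mq n : measurable_fun setT (q n).
  apply: measurable_funM => //; apply: measurable_funB => //.
  by apply: (measurableT_comp mf); exact: measurable_addr_rV.
have q0 n : (\int[leb]_x (q n x)%:E = 0)%E.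
  have i1 : leb.-integrable setT (fun x => (f (t n *: e i + x))%:E).
    have := integrable_shift (t n *: e i) (integrable_Cc Cf).
    by apply: eq_integrable => // x _; rewrite /= addrC.
  under eq_integral do rewrite EFinM EFinB.
  rewrite integralZl//; last by apply: integrableB => //; exact: integrable_Cc.
  rewrite integralB//; last exact: integrable_Cc.
  under eq_integral do rewrite addrC.
  rewrite (integral_shift (t n *: e i) (f := EFin \o f)); last exact/measurable_EFinP.
  by rewrite subee ?mule0//; apply: integrable_fin_num => //; exact: integrable_Cc.
pose B := @normball R d (K + 1).
have mB : measurable B by exact: measurable_normball.
have D : (\int[leb]_x (q n x)%:E)%E @[n --> \oo] --> (\int[leb]_x (partial i f x)%:E)%E.
  apply: (@dominated_cvg _ _ _ leb _ measurableT _ _ (fun x => (M * \1_B x)%:E)) => //.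
  - by move=> n; exact/measurable_EFinP.
  - by move=> x _; apply: cvg_EFin; [exact: nearW|exact: qcvg].
  - apply/integrableP; split.
      by apply/measurable_EFinP; apply: measurable_funM => //; exact: measurable_indic.
    under eq_integral do rewrite gee0_abs ?lee_fin ?mulr_ge0// EFinM.
    rewrite ge0_integralZl//; last exact/measurable_EFinP/measurable_indic.
    rewrite integral_indic// setIT lte_mul_pinfty ?lee_fin//.
    exact: leb_normball_lty.
  - move=> n x _; rewrite lee_fin indicE.
    have [xB|xB] := boolP (x \in B).
      rewrite mulr1 normrM gtr0_norm ?invr_gt0// ler_pdivrMl// mulrC.
      exact: smooth_increment_le (ltW (t0 n)).
    have xK : K + 1 < `|x| by rewrite ltNge; apply/negP => h; move/negP: xB; rewrite inE.
    rewrite mulr0 /q !fK ?subrr ?mulr0 ?normr0//; first by lra.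
    have := ler_normB (t n *: e i + x) (t n *: e i); rewrite addrC addKr => h.
    have : `|t n *: e i| <= 1.
      rewrite normrZ gtr0_norm// mulr_ile1//; first exact: ltW.
      apply: norm_le_coord => // j; rewrite mxE eqxx/=.
      by case: (j == i); rewrite ?normr1 ?normr0.
    by lra.
rewrite -(cvg_lim (@ereal_hausdorff R) D); apply: cvg_lim => //.
by under eq_fun do rewrite q0; exact: cvg_cst.
Qed.

Lemma integral_by_parts f g i : Cc_smooth f -> Cc_smooth g ->
  (\int[leb]_x (f x * partial i g x)%:E = - \int[leb]_x (partial i f x * g x)%:E)%E.
Proof.
move=> Cf Cg; have sf := Cc_smooth_smooth Cf; have sg := Cc_smooth_smooth Cg.
have i1 : leb.-integrable setT (fun x => (f x * partial i g x)%:E).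
  exact: (integrable_Cc (Cc_smoothM sf (Cc_smooth_partial i Cg))).
have i2 : leb.-integrable setT (fun x => (partial i f x * g x)%:E).
  exact: (integrable_Cc (Cc_smoothM (smooth_partial i sf) Cg)).
have E x : (partial i (fun x => f x * g x) x)%:E =
    ((f x * partial i g x)%:E + (partial i f x * g x)%:E)%E.
  rewrite -EFinD; congr EFin; apply: partialE.
  have ? := smooth_is_derive x i sf; have ? := smooth_is_derive x i sg.
  by apply: is_derive_eq; rewrite /GRing.scale/= [g x * _]mulrC.
have := integral_partial0 i (Cc_smoothM sf Cg).
under eq_integral do rewrite E.
rewrite integralD// => E0.
rewrite -[LHS]adde0 -(@subee _ (\int[leb]_x (partial i f x * g x)%:E)).
  by rewrite addeA E0 add0e.
exact: integrable_fin_num i2.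
Qed.

Lemma Cc_smooth_Lfun (p : R) f : 1 <= p -> Cc_smooth f -> f \in Lfun leb p%:E.
Proof.
move=> p1 Cf; have mf := smooth_measurable (Cc_smooth_smooth Cf).
have p0 : p != 0 by rewrite gt_eqF// (lt_le_trans _ p1).
have [M M0 fM] := Cc_smooth_bounded Cf; have /Cc_smoothP[_ [K fK]] := Cf.
have mB := @measurable_normball R d K.
apply/Lfun_powRP => //; split => //.
apply: (@le_lt_trans _ _ (\int[leb]_x ((M `^ p)%:E * (\1_(normball K) x)%:E))%E).
  apply: ge0_le_integral => //.
  - by apply/measurable_EFinP/(measurableT_comp (measurable_powR p)); exact: measurableT_comp.
  - apply: measurable_funeM; exact/measurable_EFinP/measurable_indic.
  move=> x _; rewrite -EFinM lee_fin indicE; have [xB|xB] := boolP (x \in normball K).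
    by rewrite mulr1 ge0_ler_powR ?nnegrE// (le_trans _ p1).
  by rewrite mulr0 fK ?normr0 ?powR0// ltNge; apply/negP => h; move/negP: xB; rewrite inE.
rewrite ge0_integralZl ?lee_fin ?powR_ge0//; last exact/measurable_EFinP/measurable_indic.
rewrite integral_indic// setIT lte_mul_pinfty ?lee_fin ?powR_ge0//.
exact: leb_normball_lty.
Qed.

Lemma Cc_smooth_W1p (p : R) f : 1 <= p -> Cc_smooth f -> W1p p f.
Proof.
move=> p1 Cf; split; first exact: Cc_smooth_Lfun.
exists (fun x => \row_i partial i f x); split => [i|i phi Cphi].
  under eq_fun do rewrite mxE.
  by apply: Cc_smooth_Lfun => //; exact: Cc_smooth_partial.
by rewrite integral_by_parts//; under [in RHS]eq_integral do rewrite mxE.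
Qed.

Lemma coord_le_enorm (x : Rd) i : `|x ord0 i| <= enorm x.
Proof. by rewrite -sqrtr_sqr ler_sqrt; [exact: sqr_coord_le|exact: sqnorm_ge0]. Qed.

Lemma Cc_smooth_BV f : Cc_smooth f -> BV f.
Proof.
move=> Cf; split; first exact: Cc_smooth_Lfun.
pose C := (\sum_i \int[leb]_x `|(partial i f x)%:E|)%E.
have Coo : (C < +oo)%E.
  apply: lte_sum_pinfty => i _.
  by have /integrableP[] := integrable_Cc (Cc_smooth_partial i Cf).
apply: le_lt_trans Coo; apply: ge_ereal_sup => _ [phi [Cphi phi1] <-].
have iF i : leb.-integrable setT (fun x => (f x * partial i (fun y => phi y ord0 i) x)%:E).
  apply: integrable_Cc; apply: Cc_smoothM; first exact: Cc_smooth_smooth.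
  exact: Cc_smooth_partial.
under eq_integral do rewrite /divergence mulr_sumr -sumEFin.
rewrite integral_sum//=.
have mpf i : measurable_fun setT (partial i f).
  by apply: smooth_measurable; apply: smooth_partial; exact: Cc_smooth_smooth.
apply: lee_sum => i _; rewrite integral_by_parts//; apply: (le_trans (lee_abs _)).
have mphi : measurable_fun setT (fun x => phi x ord0 i).
  by apply: smooth_measurable; exact: Cc_smooth_smooth.
rewrite abseN; apply: (le_trans (le_abse_integral _ _ _)) => //.
  by apply/measurable_EFinP; exact: measurable_funM.
apply: ge0_le_integral => //.
- by apply: measurableT_comp => //; apply/measurable_EFinP; exact: measurable_funM.
- by apply: measurableT_comp => //; exact/measurable_EFinP.
move=> x _; rewrite /= lee_fin normrM ler_piMr//.
exact: le_trans (coord_le_enorm _ _) (phi1 x).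
Qed.

End parts.

(** * Translations along the axes *)

Section segment.
Context {R : realType} {d : nat}.
Local Notation Rd := 'rV[R]_d.
Local Notation e i := (delta_mx ord0 i : Rd).
Local Notation U := (uniform_prob (@ltr01 R)).

Lemma integral_uniform01 (f : measurableTypeR R -> \bar R) : measurable_fun setT f ->
  (\int[U]_s f s = \int[lebesgue_measure]_(s in `[0%R, 1%R]) f s)%E.
Proof.
move=> mf; rewrite integralE [RHS]integralE !integral_uniform//.
- by rewrite subr0 invr1 !mul1e.
- exact: measurable_funeneg.
- exact: measurable_funepos.
Qed.

Lemma smooth_segment (phi : Rd -> R) (i : 'I_d) (t : R) (x : Rd) : smooth phi ->
  (\int[U]_s (- t * partial i phi (x + (- t * s) *: e i))%:E =
   (phi (x + - t *: e i) - phi x)%:E)%E.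
Proof.
move=> sphi; rewrite [x + - t *: e i]addrC; under eq_integral do rewrite [x + _]addrC.
pose k s := phi ((- t * s) *: e i + x).
pose k' s := - t * partial i phi ((- t * s) *: e i + x).
have dk (s : R) : is_derive s 1 k (k' s).
  have dl : is_derive (- t * s) 1 (fun r => phi (r *: e i + x))
    (partial i phi ((- t * s) *: e i + x)) by exact: is_derive_smooth_line.
  have dm : is_derive s 1 (fun r : R => - t * r) (- t).
    apply: is_derive_eq (_ : is_derive s 1 (fun r : R => - t *: r) (- t *: 1)) _.
    by rewrite [_ *: _]mulr1.
  rewrite /k' mulrC.
  exact: (is_derive1_comp (f := fun r => phi (r *: e i + x)) (g := fun r => - t * r)).
have ck : continuous k.
  by move=> s; apply/differentiable_continuous/derivable1_diffP; case: (dk s).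
have ck' : continuous k'.
  move=> s; apply: cvgMr.
  apply: (@continuous_comp _ _ _ (fun s => (- t * s) *: e i + x) (partial i phi)).
    apply: cvgD; last exact: cvg_cst.
    by apply: cvgZr_tmp; apply: cvgMr.
  exact/smooth_continuous/smooth_partial.
rewrite integral_uniform01; last first.
  by apply/measurable_EFinP; exact: continuous_measurable_fun.
rewrite (@continuous_FTC2 R k' k)//.
- by rewrite /k mulr1 mulr0 scale0r add0r EFinB.
- exact: continuous_subspaceT.
- split.
  + by move=> s _; case: (dk s).
  + by apply: cvg_at_right_filter; exact: ck.
  + by apply: cvg_at_left_filter; exact: ck.
- by move=> s _; rewrite derive1E; case: (dk s).
Qed.


Lemma measurable_translate (i : 'I_d) (t : R) :
  measurable_fun setT (fun z : Rd * measurableTypeR R => z.1 + (t * z.2) *: e i).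
Proof.
apply: measurable_addr_rV; first exact: measurable_fst.
by apply: measurable_scaler_rV; apply: measurable_funM => //; exact: measurable_snd.
Qed.

Lemma normr_axis (i : 'I_d) (t s : R) : 0 <= s <= 1 -> `|(t * s) *: e i| <= `|t|.
Proof.
move=> /andP[s0 s1]; apply: norm_le_coord => // j; rewrite !mxE eqxx/=.
by case: (j == i); rewrite ?mulr0 ?normr0// mulr1 normrM (ger0_norm s0) ler_piMr.
Qed.

(** For s in [0, 1] the support of the translated test function stays in a fixed
    ball, where u is integrable. *)
Lemma integrable_translates (u psi : Rd -> R) (i : 'I_d) (t : R) :
  locint u -> Cc_smooth psi ->
  (leb \x U)%E.-integrable setT (fun z => (u z.1 * psi (z.1 + (- t * z.2) *: e i))%:E).
Proof.
move=> [mu iu] Cpsi; have mpsi := smooth_measurable (Cc_smooth_smooth Cpsi).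
have [M M0 psiM] := Cc_smooth_bounded Cpsi; have /Cc_smoothP[_ [K psiK]] := Cpsi.
have mF : measurable_fun setT
    (fun z : Rd * measurableTypeR R => (u z.1 * psi (z.1 + (- t * z.2) *: e i))%:E).
  apply/measurable_EFinP/measurable_funM; first exact: (measurableT_comp mu measurable_fst).
  by apply: (measurableT_comp mpsi); exact: measurable_translate.
apply/integrable12ltyP => //.
pose B := @normball R d (K + `|t|).
have mB : measurable B by exact: measurable_normball.
apply: (@le_lt_trans _ _ (\int[leb]_x (M%:E * (`|(u x)%:E| * (\1_B x)%:E)))%E).
  apply: ge0_le_integral => //.
  - by move=> x _; exact: integral_ge0.
  - apply: (measurable_fun_fubini_tonelli_F (m2 := U)
      (fun z => `|(u z.1 * psi (z.1 + (- t * z.2) *: e i))%:E|%E)) => //.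
    exact: measurableT_comp.
  - apply: measurable_funeM; apply: emeasurable_funM.
      by apply: measurableT_comp => //; exact/measurable_EFinP.
    exact/measurable_EFinP/measurable_indic.
  move=> x _.
  have mFx : measurable_fun setT
      (fun s : measurableTypeR R => `|(u x * psi (x + (- t * s) *: e i))%:E|%E).
    have mA : measurable_fun setT (abse \o (fun z : Rd * measurableTypeR R =>
        (u z.1 * psi (z.1 + (- t * z.2) *: e i))%:E)) by exact: measurableT_comp.
    exact: (measurableT_comp mA (pair1_measurable x)).
  rewrite integral_uniform01//.
  apply: (@le_trans _ _ (\int[lebesgue_measure]_(s in `[0%R, 1%R])
      (cst (M%:E * (`|(u x)%:E| * (\1_B x)%:E)) s))%E).
    apply: ge0_le_integral => //.
    - exact: measurable_funTS.
    move=> s /=; rewrite in_itv/= => s01; rewrite -!EFinM lee_fin indicE normrM.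
    have [xB|xB] := boolP (x \in B); first by rewrite mulr1 mulrC ler_wpM2r.
    rewrite psiK ?normr0 ?mulr0//.
    have xK : K + `|t| < `|x| by rewrite ltNge; apply/negP => h; move/negP: xB; rewrite inE.
    have := normr_axis i (- t) s01; rewrite normrN => h.
    have := ler_normB (x + (- t * s) *: e i) ((- t * s) *: e i); rewrite addrK; lra.
  have l1 : lebesgue_measure (`[0, 1]%classic : set R) = 1%:E.
    by rewrite lebesgue_measure_itv/= lte_fin ltr01 sube0.
  by rewrite integral_cst// [X in (_ * X)%E]l1 mule1.
have mI : measurable_fun setT (fun x : Rd => (`|(u x)%:E| * (\1_B x)%:E)%E).
  apply: emeasurable_funM; last exact/measurable_EFinP/measurable_indic.
  by apply: measurableT_comp => //; exact/measurable_EFinP.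
rewrite ge0_integralZl ?lee_fin//.
rewrite lte_mul_pinfty ?lee_fin//.
suff -> : (\int[leb]_x (`|(u x)%:E| * (\1_B x)%:E) = \int[leb]_(x in B) `|(u x)%:E|)%E.
  by have /integrableP[] := iu (K + `|t|).
rewrite [RHS]integral_mkcond; apply: eq_integral => x _; rewrite patchE indicE.
by case: ifP => _; rewrite ?mule1 ?mule0.
Qed.

(** A translation moves the increment from u to the test function, where it is the
    integral of a derivative along a segment. *)
Lemma shift_pairing (u phi : Rd -> R) (i : 'I_d) (t : R) : locint u -> Cc_smooth phi ->
  (\int[leb]_x ((u (x + t *: e i) - u x) * phi x)%:E =
   \int[U]_s \int[leb]_x (u x * (- t * partial i phi (x + (- t * s) *: e i)))%:E)%E.
Proof.
move=> lu Cphi; have lus := locint_shift (t *: e i) lu; have sphi := Cc_smooth_smooth Cphi.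
have Cpsi : Cc_smooth (fun x => - t * partial i phi x).
  apply: (@Cc_smoothM _ _ (fun=> - t)); last exact: Cc_smooth_partial.
  by apply/smoothP => n; exact: Ck_cst.
have mu : measurable_fun setT u by case: lu.
have mphi := smooth_measurable sphi.
have i1 := integrable_locintM lus Cphi.
have i2 := integrable_locintM lu Cphi.
have i3 := integrable_locintM lu (Cc_smooth_shift (- t *: e i) Cphi).
have iF := integrable_translates i t lu Cpsi.
transitivity (\int[leb]_x (u x * (phi (x + - t *: e i) - phi x))%:E)%E.
  under eq_integral do rewrite mulrBl EFinB.
  rewrite integralB//; under [RHS]eq_integral do rewrite mulrBr EFinB.
  rewrite [RHS]integralB//; congr (_ - _)%E.
  rewrite -(integral_shift (t *: e i) (f := fun x => (u x * phi (x + - t *: e i))%:E)).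
    by apply: eq_integral => x _; rewrite scaleNr addrK.
  exact: measurable_int i3.
rewrite -(Fubini iF)/=; apply: eq_integral => x _.
rewrite EFinM -smooth_segment// -integralZl//.
have mpsi := smooth_measurable (Cc_smooth_smooth Cpsi).
have [M M0 psiM] := Cc_smooth_bounded Cpsi.
apply: (@le_integrable _ _ _ _ _ measurableT _ (cst M%:E)).
- apply/measurable_EFinP.
  exact: (measurableT_comp (measurableT_comp mpsi (measurable_translate i (- t)))
    (pair1_measurable x)).
- by move=> s _; rewrite /= lee_fin (ger0_norm M0).
- exact: finite_measure_integrable_cst.
Qed.

End segment.

(** * Difference quotients of BV and Sobolev functions *)

Section fubini_inner.
Context d1 d2 (T1 : measurableType d1) (T2 : measurableType d2) (R : realType).
Variables (m1 : {sigma_finite_measure set T1 -> \bar R})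
  (m2 : {sigma_finite_measure set T2 -> \bar R}).

Lemma integrable_inner2 (f : T1 * T2 -> \bar R) :
  (m1 \x m2)%E.-integrable setT f ->
  m2.-integrable setT (fun y => \int[m1]_x f (x, y))%E.
Proof.
move=> if_; have mf : measurable_fun setT f by exact: measurable_int if_.
have mG : measurable_fun setT (fun y => \int[m1]_x f (x, y))%E.
  exact: (measurable_fubini_G if_).
apply/integrableP; split => //.
apply: le_lt_trans ((integrable21ltyP m1 m2 mf).1 if_); apply: ge0_le_integral => //.
- exact: measurableT_comp.
- apply: (measurable_fun_fubini_tonelli_G (abse \o f)) => //=.
  exact: measurableT_comp.
move=> y _; apply: le_abse_integral => //.
exact: (measurableT_comp mf (pair2_measurable y)).
Qed.

End fubini_inner.

Section shifts.
Context {R : realType} {d : nat}.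
Local Notation Rd := 'rV[R]_d.
Local Notation e i := (delta_mx ord0 i : Rd).
Local Notation U := (uniform_prob (@ltr01 R)).

Lemma integrable_shift_pairing (u phi : Rd -> R) (i : 'I_d) (t : R) :
  locint u -> Cc_smooth phi -> U.-integrable setT
    (fun s => \int[leb]_x (u x * (- t * partial i phi (x + (- t * s) *: e i)))%:E)%E.
Proof.
move=> lu Cphi.
have Cpsi : Cc_smooth (fun x => - t * partial i phi x).
  apply: (@Cc_smoothM _ _ (fun=> - t)); last exact: Cc_smooth_partial.
  by apply/smoothP => n; exact: Ck_cst.
exact: (integrable_inner2 (integrable_translates i t lu Cpsi)).
Qed.

Lemma variation_ge0 (u : Rd -> R) : (0 <= Defs.variation u)%E.
Proof.
apply: ereal_sup_ubound; exists (fun=> 0).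
  split => [i|x]; first by under eq_fun do rewrite mxE; exact: Cc_smooth_cst0.
  by rewrite /enorm big1 ?sqrtr0// => i _; rewrite mxE expr0n.
rewrite integral0_eq// => x _; rewrite /divergence big1 ?mulr0// => i _.
by rewrite /partial derive_cst.
Qed.

(** The pairing of the increment with a test function phi is an average of
    pairings of u with divergences of fields parallel to the axis. *)
Lemma BV_shift_le (u : Rd -> R) (i : 'I_d) (t : R) : BV u ->
  (\int[leb]_x `|u (x + t *: e i) - u x|%:E <= `|t|%:E * Defs.variation u)%E.
Proof.
move=> [uL uV].
have lu : locint u by exact: Lfun_locint uL.
have Vfin : Defs.variation u \is a fin_num by rewrite ge0_fin_numE// variation_ge0.
pose V := fine (Defs.variation u); have VE : Defs.variation u = V%:E by rewrite fineK.
have V0 : 0 <= V by rewrite fine_ge0// variation_ge0.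
have iu : leb.-integrable setT (EFin \o u) by apply/Lfun1_integrable.
pose w x := u (x + t *: e i) - u x.
have iw : leb.-integrable setT (EFin \o w).
  have := integrableB measurableT (integrable_shift (t *: e i) iu) iu.
  by apply: eq_integrable.
have mw : measurable_fun setT w by apply/measurable_EFinP; exact: measurable_int iw.
suff H : (\int[leb]_x (Num.max (`|w x| - 0) 0)%:E <= (`|t| * V)%:E)%E.
  rewrite VE -EFinM; apply: le_trans H; rewrite le_eqVlt; apply/orP; left; apply/eqP.
  by apply: eq_integral => x _; rewrite subr0 (max_idPl _).
apply: (integral_excess_le (a := fun=> 0)) => //; first exact: integrable0.
move=> phi Cphi phi1; have sphi := Cc_smooth_smooth Cphi.
under eq_integral do rewrite mul0r subr0.
rewrite shift_pairing//.
have iG := integrable_shift_pairing i t lu Cphi.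
apply: (@le_trans _ _ (\int[U]_s (cst (`|t| * V)%:E s))%E); last first.
  rewrite integral_cst// [X in (_ * X)%E](_ : _ = 1%E) ?mule1//.
  exact: (@probability_setT _ _ _ U).
apply: le_integral => //; first exact: finite_measure_integrable_cst.
move=> s _; rewrite /=.
(* The field along the axis i whose divergence times |t| is the integrand. *)
have Cs : Cc_smooth (fun x => phi (x + (- t * s) *: e i)) by exact: Cc_smooth_shift.
pose Phi (x : Rd) : Rd := (- Num.sg t * phi (x + (- t * s) *: e i)) *: e i.
have PhiE j x : Phi x ord0 j = (- Num.sg t * (j == i)%:R) * phi (x + (- t * s) *: e i).
  by rewrite !mxE eqxx/= mulrAC.
have CPhi j : Cc_smooth (fun x => Phi x ord0 j).
  under eq_fun do rewrite PhiE.
  apply: (Cc_smoothM _ Cs); apply/smoothP => n; exact: Ck_cst.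
have divE x : divergence Phi x = - Num.sg t * partial i phi (x + (- t * s) *: e i).
  have E j : partial j (fun y => Phi y ord0 j) x =
      (- Num.sg t * (j == i)%:R) * partial j phi (x + (- t * s) *: e i).
    rewrite -(partial_shift _ _ _ sphi); under eq_fun do rewrite PhiE.
    apply: partialE; have ? := smooth_is_derive x j (Cc_smooth_smooth Cs).
    exact: is_deriveZ.
  rewrite /divergence (bigD1 i)//= E eqxx mulr1 big1 ?addr0// => j ji.
  by rewrite E (negbTE ji) mulr0 mul0r.
have Phi1 x : enorm (Phi x) <= 1.
  rewrite /enorm (bigD1 i)//= big1 ?addr0 => [|j ji]; last first.
    by rewrite PhiE (negbTE ji) mulr0 mul0r expr0n.
  rewrite PhiE eqxx mulr1 sqrtr_sqr normrM normrN normr_sg.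
  by rewrite mulr_ile1//; case: (t != 0).
have : (\int[leb]_x (u x * divergence Phi x)%:E <= V%:E)%E.
  by rewrite -VE; apply: ereal_sup_ubound; exists Phi.
rewrite (_ : (fun x => _) = (fun x => (`|t|%:E * (u x * divergence Phi x)%:E)%E)); last first.
  apply/funext => x; rewrite -EFinM divE; congr EFin.
  by set y := partial i phi _; rewrite [t in LHS]numEsg; ring.
move=> H; rewrite integralZl//; first by rewrite EFinM lee_wpmul2l// lee_fin.
apply: (integrable_locintM lu).
have -> : divergence Phi = (fun x => - Num.sg t * partial i phi (x + (- t * s) *: e i)).
  exact/funext.
apply: (@Cc_smoothM _ _ (fun=> _)); first by apply/smoothP => n; exact: Ck_cst.
exact/Cc_smooth_shift/Cc_smooth_partial.
Qed.

End shifts.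


Section sobolev_shift.
Context {R : realType} {d : nat}.
Local Notation Rd := 'rV[R]_d.
Local Notation e i := (delta_mx ord0 i : Rd).
Local Notation U := (uniform_prob (@ltr01 R)).

(** Jensen's inequality, as Hoelder's inequality against the constant 1. *)
Lemma average_powR_le (f : measurableTypeR R -> R) (p : R) : 1 < p ->
  measurable_fun setT f ->
  ((\int[U]_s `|f s|%:E) `^ p <= \int[U]_s (`|f s| `^ p)%:E)%E.
Proof.
move=> p1 mf; have p0 : 0 < p by rewrite (lt_trans _ p1).
have q0 : 0 < 1 - p^-1 by rewrite subr_gt0 invf_lt1.
have := @hoelder _ _ _ U f (cst 1) p (1 - p^-1)^-1 mf (measurable_cst _) p0.
rewrite invr_gt0 => /(_ q0); rewrite invrK addrC subrK => /(_ erefl).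
rewrite Lnorm1 (_ : EFin \o cst 1 = cst 1%E)// Lnorm_cst1.
rewrite [X in (_ * X `^ _)%E](_ : _ = 1%E); last exact: (@probability_setT _ _ _ U).
rewrite poweR1r mule1 => H.
have H1 : (\int[U]_s `|f s|%:E <= Lnorm U p%:E (EFin \o f))%E.
  by apply: le_trans H; under [X in (_ <= X)%E]eq_integral do rewrite /= mulr1.
apply: (@le_trans _ _ (Lnorm U p%:E (EFin \o f) `^ p)%E).
  apply: gt0_ler_poweR => //; first exact: ltW.
  - by rewrite in_itv/= leey andbT; apply: integral_ge0 => s _; rewrite lee_fin.
  - by rewrite in_itv/= leey andbT Lnorm_ge0.
by rewrite powR_Lnorm ?gt_eqF.
Qed.

(** The weak derivative g gives, through the pairing with test functions, the
    bound of the increment of u by the average of |g| over the segment swept by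
    the translation; then Jensen's inequality applies. *)
Lemma W1p_shift_le (p : R) (u : Rd -> R) (g : Rd -> Rd) (i : 'I_d) (t : R) : 1 < p ->
  u \in Lfun leb p%:E -> weak_gradient p u g ->
  (\int[leb]_x (`|u (x + t *: e i) - u x| `^ p)%:E <=
   (`|t| `^ p)%:E * \int[leb]_x (`|g x ord0 i| `^ p)%:E)%E.
Proof.
move=> p1 uL ug; have [gL _] := ug; have p1' := ltW p1; have p0 : 0 < p by rewrite (lt_trans _ p1).
have pn0 : p != 0 by rewrite gt_eqF.
pose gi x := g x ord0 i.
have [mgi giL] := (Lfun_powRP gi p1').1 (gL i).
have lu := Lfun_locint p1' uL; have lg := Lfun_locint p1' (gL i).
have lus := locint_shift (t *: e i) lu.
pose w x := u (x + t *: e i) - u x.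
have lw : locint w by exact: locintB.
have mw : measurable_fun setT w by case: lw.
pose sh (z : Rd * measurableTypeR R) : Rd := z.1 + (t * z.2) *: e i.
have msh : measurable_fun setT sh by exact: measurable_translate.
(* A x is the average of |g_i| over the segment from x to x + t e_i, and b below
   is its real-valued version. *)
pose A x : \bar R := (\int[U]_s `|gi (x + (t * s) *: e i)|%:E)%E.
have mabs : measurable_fun setT (fun z => `|gi (sh z)|%:E).
  by apply/measurable_EFinP/measurableT_comp => //; exact: (measurableT_comp mgi msh).
have A0 x : (0 <= A x)%E by apply: integral_ge0 => s _; rewrite lee_fin.
have mA : measurable_fun setT A.
  exact: (measurable_fun_fubini_tonelli_F (m2 := U) (fun z => `|gi (sh z)|%:E)).
pose N : \bar R := (\int[leb]_x (`|gi x| `^ p)%:E)%E.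
have mgp : measurable_fun setT (fun x => (`|gi x| `^ p)%:E).
  by apply/measurable_EFinP/(measurableT_comp (measurable_powR p)); exact: measurableT_comp.
have mAp : measurable_fun setT (fun x => A x `^ p)%E.
  exact: (measurableT_comp (measurable_poweR p) mA).
have AN : (\int[leb]_x (A x `^ p) <= N)%E.
  have mgsp : measurable_fun setT (fun z => (`|gi (sh z)| `^ p)%:E).
    exact: (measurableT_comp mgp msh).
  apply: (@le_trans _ _ (\int[leb]_x \int[U]_s (`|gi (x + (t * s) *: e i)| `^ p)%:E)%E).
    apply: ge0_le_integral => //.
    - by move=> x _; exact: poweR_ge0.
    - exact: (measurable_fun_fubini_tonelli_F (m2 := U) (fun z => (`|gi (sh z)| `^ p)%:E)).
    move=> x _; apply: average_powR_le => //.
    exact: (measurableT_comp mgi (measurableT_comp msh (pair1_measurable x))).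
  rewrite (fubini_tonelli (m2 := U) (fun z => (`|gi (sh z)| `^ p)%:E))//=.
  rewrite (eq_integral (cst N)) => [|s _]; last first.
    by rewrite -[RHS](ge0_integral_shift ((t * s) *: e i)).
  rewrite integral_cst// [X in (_ * X)%E](_ : _ = 1%E) ?mule1//.
  exact: (@probability_setT _ _ _ U).
pose b x := fine (A x).
have b0 x : 0 <= b x by exact: fine_ge0.
have mb : measurable_fun setT b by exact: (measurableT_comp (fine_measurable measurableT) mA).
have bA x : ((b x `^ p)%:E <= A x `^ p)%E.
  rewrite /b; have := A0 x; case: (A x) => [r|_|//]; first by rewrite poweR_EFin.
  by rewrite poweRyr// leey.
have mbp : measurable_fun setT (fun x => (b x `^ p)%:E).
  by apply/measurable_EFinP/(measurableT_comp (measurable_powR p)).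
have bN : (\int[leb]_x (b x `^ p)%:E <= N)%E.
  apply: le_trans AN; apply: ge0_le_integral => //.
  by move=> x _; rewrite lee_fin powR_ge0.
have lb : locint b.
  apply: (Lfun_locint p1'); apply: (Lfun_powRP b p1').2; split; first exact: mb.
  by apply: le_lt_trans giL; under eq_integral do rewrite ger0_norm//; exact: bN.
pose a x := `|t| * b x.
have a0 x : 0 <= a x by rewrite mulr_ge0.
have la : locint a.
  split=> [|K]; first exact: measurable_funM.
  have [_ ib] := lb; have := integrableZl (@measurable_normball R d K) `|t| (ib K).
  by apply: eq_integrable => //; exact: measurable_normball.
have aE x : a x = `|t| * b x by [].
clearbody a.
(* A is finite almost everywhere because A^p is integrable. *)
have aeA : {ae leb, forall x, A x = (b x)%:E}.
  have iA : leb.-integrable setT (fun x => A x `^ p)%E.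
    apply/integrableP; split => //; under eq_integral do rewrite gee0_abs ?poweR_ge0//.
    exact: le_lt_trans AN giL.
  have := integrable_ae measurableT iA; apply: filterS => x /(_ I) Afin.
  rewrite /b fineK// ge0_fin_numE//; apply: (lty_poweRy pn0).
  by rewrite -ge0_fin_numE ?poweR_ge0.
(* Integrating by parts in the pairing, and moving the translation back. *)
have pairing phi : Cc_smooth phi -> (\int[leb]_x (w x * phi x)%:E <= \int[leb]_x (a x * `|phi x|)%:E)%E.
  move=> Cphi; have sphi := Cc_smooth_smooth Cphi; have mphi := smooth_measurable sphi.
  rewrite shift_pairing//.
  pose q (z : Rd * measurableTypeR R) : \bar R := (`|gi (sh z)| * `|phi z.1|)%:E.
  have mq : measurable_fun setT q.
    apply/measurable_EFinP/measurable_funM.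
      by apply: measurableT_comp => //; exact: (measurableT_comp mgi msh).
    by apply: measurableT_comp => //; exact: (measurableT_comp mphi measurable_fst).
  have q0 z : (0 <= q z)%E by rewrite lee_fin.
  apply: (@le_trans _ _ (\int[U]_s (`|t|%:E * \int[leb]_x q (x, s)))%E); last first.
    have mQ := measurable_fun_fubini_tonelli_G (m1 := leb) q mq q0.
    rewrite ge0_integralZl//; last by move=> s _; exact: integral_ge0.
    rewrite -(fubini_tonelli (m1 := leb) q mq q0) -ge0_integralZl//; last 2 first.
    - exact: (measurable_fun_fubini_tonelli_F (m2 := U) q mq q0).
    - by move=> x _; exact: integral_ge0.
    have mphi' : measurable_fun setT (fun x => (`|phi x|)%:E).
      by apply/measurable_EFinP; exact: measurableT_comp.
    apply: ae_ge0_le_integral => //.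
    - by move=> x _; rewrite mule_ge0// integral_ge0.
    - apply: measurable_funeM.
      exact: (measurable_fun_fubini_tonelli_F (m2 := U) q mq q0).
    - by move=> x _; rewrite lee_fin mulr_ge0.
    - apply/measurable_EFinP/measurable_funM; first by case: la.
      exact: measurableT_comp.
    apply: filterS aeA => x Ax _.
    have -> : (\int[U]_s q (x, s) = A x * (`|phi x|)%:E)%E.
      rewrite -ge0_integralZr//.
      by apply/measurable_EFinP/measurableT_comp => //;
        exact: (measurableT_comp mgi (measurableT_comp msh (pair1_measurable x))).
    by rewrite Ax -!EFinM aE mulrA.
  have iG := integrable_shift_pairing i t lu Cphi.
  apply: (le_trans (lee_abs _)); apply: (le_trans (le_abse_integral _ _ _)) => //.
    exact: measurable_int iG.
  apply: ge0_le_integral => //.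
  - by apply: measurableT_comp => //; exact: measurable_int iG.
  - apply: measurable_funeM.
    exact: (measurable_fun_fubini_tonelli_G (m1 := leb) q mq q0).
  move=> s _.
  pose phis x := phi (x + (- t * s) *: e i).
  have Cs : Cc_smooth phis by exact: Cc_smooth_shift.
  have ius : leb.-integrable setT (fun x => (u x * partial i phis x)%:E).
    exact: (integrable_locintM lu (Cc_smooth_partial i Cs)).
  have E1 : (\int[leb]_x (u x * (- t * partial i phi (x + (- t * s) *: e i)))%:E =
      (- t)%:E * \int[leb]_x (u x * partial i phis x)%:E)%E.
    rewrite -(integralZl measurableT ius); apply: eq_integral => x _.
    by rewrite /phis partial_shift// -EFinM mulrCA.
  rewrite E1 (ug.2 i phis Cs) EFinN muleNN.
  rewrite abseM lee_wpmul2l//.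
  have mgphi : measurable_fun setT (fun x => gi x * phis x).
    by apply: measurable_funM => //; exact: smooth_measurable (Cc_smooth_smooth Cs).
  apply: (le_trans (le_abse_integral _ _ _)) => //; first exact/measurable_EFinP.
  rewrite -[X in (X <= _)%E](ge0_integral_shift ((t * s) *: e i)) => [||x]; last 2 first.
  - by apply: measurableT_comp => //; exact/measurable_EFinP.
  - by rewrite lee_fin.
  rewrite le_eqVlt; apply/orP; left; apply/eqP; apply: eq_integral => x _.
  by rewrite /= /phis mulNr scaleNr addrK normrM.
(* w and a are only locally integrable, hence the cutoffs. *)
have excess n : (\int[leb]_x (Num.max (`|w x * cutoff n%:R x| - a x * cutoff n%:R x) 0)%:E <= 0%:E)%E.
  have Cn := @Cc_smooth_cutoff R d n%:R.
  apply: integral_excess_le.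
  - exact: integrable_locintM.
  - exact: integrable_locintM.
  - by move=> x; rewrite mulr_ge0// cutoff_ge0.
  move=> phi Cphi _; have Cphi' := Cc_smoothM (Cc_smooth_smooth Cn) Cphi.
  have i1 := integrable_locintM lw Cphi'.
  have i2 := integrable_abse (integrable_locintM la Cphi').
  rewrite (_ : (fun x => _) = (fun x => ((w x * (cutoff n%:R x * phi x))%:E -
      `|(a x * (cutoff n%:R x * phi x))%:E|)%E)).
    rewrite integralB// sube_le0; apply: (le_trans (pairing _ Cphi')).
    rewrite le_eqVlt; apply/orP; left; apply/eqP; apply: eq_integral => x _.
    by rewrite [RHS]/= [in RHS]normrM (ger0_norm (a0 x)).
  apply/funext => x; rewrite /= -EFinD; congr EFin; congr (_ - _).
    by rewrite mulrA.
  by rewrite !normrM (ger0_norm (a0 x)) (ger0_norm (cutoff_ge0 _ _)) mulrA.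
have ae_le : {ae leb, forall x, `|w x| <= a x}.
  have H n : {ae leb, forall x, `|w x * cutoff n%:R x| <= a x * cutoff n%:R x}.
    have mM : measurable_fun setT (fun x =>
        Num.max (`|w x * cutoff n%:R x| - a x * cutoff n%:R x) 0).
      have mc := smooth_measurable (Cc_smooth_smooth (@Cc_smooth_cutoff R d n%:R)).
      have ma : measurable_fun setT a by case: la.
      apply: measurable_maxr => //; apply: measurable_funB; last exact: measurable_funM.
      by apply: measurableT_comp => //; exact: measurable_funM.
    have E0 : (\int[leb]_x `|(Num.max (`|w x * cutoff n%:R x| - a x * cutoff n%:R x) 0)%:E| = 0)%E.
      apply/eqP; rewrite eq_le integral_ge0// andbT; apply: le_trans (excess n).
      rewrite le_eqVlt; apply/orP; left; apply/eqP; apply: eq_integral => x _.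
      by rewrite gee0_abs// lee_fin le_max lexx orbT.
    have [N0 [mN0 N00 sub]] :=
      (ae_eq_integral_abs leb measurableT ((measurable_EFinP _ _).2 mM)).1 E0.
    exists N0; split => // x Hx; apply: sub => /= /(_ I)[/eqP].
    rewrite eq_maxr subr_le0 => h; exact: Hx.
  have := ae_foralln H; apply: filterS => x Hx.
  have [n xn] : exists n : nat, sqnorm x < n%:R.
    by exists (Num.truncn (sqnorm x)).+1; rewrite truncnS_gt.
  have cn := cutoff_gt0 xn; have := Hx n.
  by rewrite normrM (gtr0_norm cn) ler_pM2r.
apply: (@le_trans _ _ (\int[leb]_x (a x `^ p)%:E)%E).
  have ma : measurable_fun setT a by case: la.
  apply: ae_ge0_le_integral => //.
  - apply/measurable_EFinP/(measurableT_comp (measurable_powR p)).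
    exact: measurableT_comp.
  - by move=> x _; rewrite lee_fin powR_ge0.
  - by apply/measurable_EFinP; exact: (measurableT_comp (measurable_powR p) ma).
  - apply: filterS ae_le => x wa _; rewrite lee_fin ge0_ler_powR ?nnegrE//.
    exact: ltW.
rewrite (_ : (fun x => (a x `^ p)%:E) = (fun x => ((`|t| `^ p)%:E * (b x `^ p)%:E)%E)); last first.
  by apply/funext => x; rewrite -EFinM aE powRM.
have bp0 x : setT x -> (0 <= (b x `^ p)%:E)%E by rewrite lee_fin powR_ge0.
rewrite (ge0_integralZl _ measurableT mbp bp0) ?lee_fin ?powR_ge0//.
by rewrite lee_wpmul2l// lee_fin powR_ge0.
Qed.

End sobolev_shift.

(** * Increments in an arbitrary direction *)

Section increments.
Context {R : realType} {d : nat}.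
Local Notation Rd := 'rV[R]_d.
Local Notation e i := (delta_mx ord0 i : Rd).
Implicit Types (u : Rd -> R) (h : Rd) (p : R).

(** Each term is at most the l^p norm of the family. *)
Lemma powR_sum_le p (I : finType) (a : I -> R) : 0 < p -> (forall i, 0 <= a i) ->
  (\sum_i a i) `^ p <= #|I|%:R `^ p * \sum_i a i `^ p.
Proof.
move=> p0 a0; set S := \sum_i a i `^ p.
have S0 : 0 <= S by apply: sumr_ge0 => i _; exact: powR_ge0.
have aS i : a i <= S `^ p^-1.
  rewrite -[leLHS](powRr1 (a0 i)) -(divff (lt0r_neq0 p0)) powRrM.
  have pV0 : 0 <= p^-1 by rewrite invr_ge0 ltW.
  rewrite (ge0_ler_powR pV0) ?nnegrE ?powR_ge0//.
  rewrite /S (bigD1 i)//= lerDl; apply: sumr_ge0 => j _; exact: powR_ge0.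
have : \sum_i a i <= #|I|%:R * S `^ p^-1.
  by rewrite mulr_natl -sumr_const; apply: ler_sum => i _; exact: aS.
move=> /(ge0_ler_powR (ltW p0)); rewrite !nnegrE => /(_ _ _)/le_trans; apply.
- by apply: sumr_ge0.
- by rewrite mulr_ge0// powR_ge0.
by rewrite powRM ?powR_ge0// -powRrM mulVf ?gt_eqF// powRr1.
Qed.

(** The energy is the integral of these quantities against the kernel. *)
Definition incr p u h : \bar R := (\int[leb]_x (`|u (x + h)%R - u x| `^ p)%:E)%E.

Lemma incr_ge0 p u h : (0 <= incr p u h)%E.
Proof. by apply: integral_ge0 => x _; rewrite lee_fin powR_ge0. Qed.

Lemma measurable_incr_integrand p u (h k : Rd) : measurable_fun setT u ->
  measurable_fun setT (fun x : Rd => (`|u (x + h) - u (x + k)| `^ p)%:E).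
Proof.
move=> mu; apply/measurable_EFinP/(measurableT_comp (measurable_powR p)).
apply: measurableT_comp => //.
by apply: measurable_funB; apply: (measurableT_comp mu); exact: measurable_shift.
Qed.

Lemma incr_shift p u (h k : Rd) : measurable_fun setT u ->
  (\int[leb]_x (`|u (x + k + h)%R - u (x + k)%R| `^ p)%:E = incr p u h)%E.
Proof.
move=> mu; rewrite /incr -[RHS](ge0_integral_shift k)//.
by have := measurable_incr_integrand p h 0 mu; under eq_fun do rewrite addr0.
Qed.

Lemma incr_le_norm p u h : 0 < p -> measurable_fun setT u ->
  (incr p u h <= (2 `^ p * 2)%:E * \int[leb]_x (`|u x| `^ p)%:E)%E.
Proof.
move=> p0 mu.
have mup : measurable_fun setT (fun x => (`|u x| `^ p)%:E).
  by apply/measurable_EFinP/(measurableT_comp (measurable_powR p)); exact: measurableT_comp.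
have mush : measurable_fun setT (fun x : Rd => (`|u (x + h)| `^ p)%:E).
  exact: (measurableT_comp mup (measurable_shift h)).
apply: (@le_trans _ _ (\int[leb]_x ((2 `^ p)%:E * ((`|u (x + h)%R| `^ p)%:E + (`|u x| `^ p)%:E)))%E).
  apply: ge0_le_integral => //.
  - by have := measurable_incr_integrand p h 0 mu; under eq_fun do rewrite addr0.
  - by apply: measurable_funeM; exact: emeasurable_funD.
  move=> x _; rewrite -EFinD -EFinM lee_fin.
  have H := @powR_sum_le p bool (fun b => if b then `|u (x + h)| else `|u x|) p0.
  rewrite !big_bool/= card_bool in H; apply: le_trans (H _); last by case.
  by rewrite (ge0_ler_powR (ltW p0)) ?nnegrE ?addr_ge0// ler_normB.
have mD : measurable_fun setT (fun x : Rd => (`|u (x + h)%R| `^ p)%:E + (`|u x| `^ p)%:E)%E.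
  exact: emeasurable_funD.
have P0 (x : R) : (0 <= (x `^ p)%:E)%E by rewrite lee_fin powR_ge0.
rewrite ge0_integralZl//=; last by move=> x _; exact: adde_ge0.
rewrite ge0_integralD//.
rewrite (ge0_integral_shift h (f := fun x => (`|u x| `^ p)%:E))//.
rewrite EFinM -muleA lee_wpmul2l ?lee_fin ?powR_ge0//.
by rewrite mule_natl mule2n.
Qed.

(** The point x + h is reached from x along the coordinate axes; translation
    invariance removes the intermediate points. *)
Lemma incr_axes p u h : 0 < p -> measurable_fun setT u ->
  (incr p u h <= (d%:R `^ p)%:E * \sum_(k < d) incr p u (h ord0 k *: e k))%E.
Proof.
move=> p0 mu.
(* hs k has the first k coordinates of h. *)
pose hs (k : nat) : Rd := \row_j (if (j < k)%N then h ord0 j else 0).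
have hs0 : hs 0%N = 0 by apply/rowP => j; rewrite !mxE.
have hsd : hs d = h by apply/rowP => j; rewrite !mxE ltn_ord.
have hsS (k : 'I_d) : hs k.+1 = hs k + h ord0 k *: e k.
  apply/rowP => j; rewrite !mxE eqxx/= ltnS leq_eqVlt val_eqE.
  by have [->|_] := eqVneq j k; rewrite ?ltnn ?add0r ?mulr1 ?mulr0 ?addr0.
have tele x : `|u (x + h) - u x| <= \sum_(k < d) `|u (x + hs k + h ord0 k *: e k) - u (x + hs k)|.
  have -> : u (x + h) - u x = \sum_(k < d) (u (x + hs k + h ord0 k *: e k) - u (x + hs k)).
    have := telescope_sumr (fun k => u (x + hs k)) (leq0n d).
    rewrite hsd hs0 addr0 => <-; rewrite big_mkord; apply: eq_bigr => k _.
    by rewrite hsS addrA.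
  exact: ler_norm_sum.
have mk (k : 'I_d) : measurable_fun setT
    (fun x : Rd => (`|u (x + hs k + h ord0 k *: e k) - u (x + hs k)| `^ p)%:E).
  have := measurable_incr_integrand p (hs k + h ord0 k *: e k) (hs k) mu.
  by under eq_fun do rewrite addrA.
apply: (@le_trans _ _ (\int[leb]_x ((d%:R `^ p)%:E * \sum_(k < d)
    (`|u (x + hs k + h ord0 k *: e k)%R - u (x + hs k)%R| `^ p)%:E))%E).
  apply: ge0_le_integral => //.
  - by have := measurable_incr_integrand p h 0 mu; under eq_fun do rewrite addr0.
  - by apply: measurable_funeM; apply: emeasurable_sum.
  move=> x _; rewrite sumEFin -EFinM lee_fin.
  have := powR_sum_le p0 (fun k : 'I_d => normr_ge0 (u (x + hs k + h ord0 k *: e k) - u (x + hs k))).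
  rewrite card_ord; apply: le_trans.
  by rewrite (ge0_ler_powR (ltW p0)) ?nnegrE// sumr_ge0.
have mS : measurable_fun setT (fun x : Rd => \sum_(k < d)
    (`|u (x + hs k + h ord0 k *: e k)%R - u (x + hs k)%R| `^ p)%:E)%E.
  exact: emeasurable_sum.
have P0 (x : R) : (0 <= (x `^ p)%:E)%E by rewrite lee_fin powR_ge0.
rewrite ge0_integralZl//=; last by move=> x _; apply: sume_ge0.
rewrite (ge0_integral_sum _ measurableT) => [|k|k x _]; [|exact: mk|exact: P0].
rewrite le_eqVlt; apply/orP; left; apply/eqP; congr (_ * _)%E.
by apply: eq_bigr => k _; exact: incr_shift.
Qed.

(** Translations by at least 1 cost the norm of u, those by less than 1 the
    gradient N. *)
Lemma incr_le_min p u h (N : \bar R) : 0 < p -> measurable_fun setT u -> (0 <= N)%E ->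
  (forall k t, incr p u (t *: e k) <= (`|t| `^ p)%:E * N)%E ->
  (incr p u h <= (2 `^ p * 2 + d%:R `^ p * d%:R)%:E *
    ((Num.min 1 (enorm h `^ p))%:E * (\int[leb]_x (`|u x| `^ p)%:E + N)))%E.
Proof.
move=> p0 mu N0 uN.
have I0 : (0 <= \int[leb]_x (`|u x| `^ p)%:E)%E.
  by apply: integral_ge0 => x _; rewrite lee_fin powR_ge0.
have C1 : 0 <= (2 `^ p * 2 : R) by rewrite mulr_ge0 ?powR_ge0.
have C2 : 0 <= (d%:R `^ p * d%:R : R) by rewrite mulr_ge0 ?powR_ge0.
have [h1|h1] := leP 1 (enorm h `^ p).
  rewrite mul1e; apply: (le_trans (incr_le_norm h p0 mu)).
  by rewrite lee_pmul ?lee_fin ?lerDl// leeDl.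
apply: (@le_trans _ _ ((d%:R `^ p * d%:R)%:E * ((enorm h `^ p)%:E * N))%E); last first.
  rewrite lee_pmul ?lee_fin ?mule_ge0 ?lee_fin ?powR_ge0 ?lerDr//.
  by rewrite lee_wpmul2l ?lee_fin ?powR_ge0// leeDr.
apply: (le_trans (incr_axes h p0 mu)); rewrite EFinM -muleA.
rewrite lee_wpmul2l ?lee_fin ?powR_ge0//.
apply: (@le_trans _ _ (\sum_(k < d) (enorm h `^ p)%:E * N)%E).
  apply: lee_sum => k _; apply: (le_trans (uN _ _)).
  rewrite lee_wpmul2r// lee_fin (ge0_ler_powR (ltW p0)) ?nnegrE ?sqrtr_ge0//.
  exact: coord_le_enorm.
by rewrite sumr_const card_ord mule_natl.
Qed.

End increments.

(** * The energy as an integral over the increments *)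

Section energy.
Context {R : realType} {d : nat}.
Local Notation Rd := 'rV[R]_d.
Variables (nu nu' : Rd -> R) (N : set Rd) (p : R).
Hypotheses (p0 : 0 < p) (mN : measurable N) (N0 : leb N = 0%E).
Hypotheses (mnu' : measurable_fun setT nu') (nu'0 : forall h, 0 <= nu' h).
Hypothesis nuE : forall h, ~ N h -> nu' h = nu h.
Hypothesis nu_ge0 : forall h, h != 0 -> 0 <= nu h.
Hypothesis nu_sym : forall h, h != 0 -> nu (- h) = nu h.

(** With y = x + h, the symmetry of the kernel turns nu (x - y) into nu h; then
    the order of integration is exchanged. *)
Lemma energy_incr (u : Rd -> R) : measurable_fun setT u ->
  energy nu p u = (\int[leb]_h ((nu' h)%:E * incr p u h))%E.
Proof.
move=> mu; have pn0 : p != 0 by rewrite gt_eqF.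
pose F (x y : Rd) : \bar R := (`|u x - u (x + y)| `^ p * nu' y)%:E.
have F0 x y : (0 <= F x y)%E by rewrite lee_fin mulr_ge0 ?powR_ge0.
have mF : measurable_fun setT (fun z => F z.1 z.2).
  apply/measurable_EFinP/measurable_funM; last exact: (measurableT_comp mnu' measurable_snd).
  apply: (measurableT_comp (measurable_powR p)); apply: measurableT_comp => //.
  apply: measurable_funB; first exact: (measurableT_comp mu measurable_fst).
  apply: (measurableT_comp mu); apply: measurable_addr_rV.
    exact: measurable_fst.
  exact: measurable_snd.
have inner x : (\int[leb]_y (`|u x - u y| `^ p * nu (x - y))%:E = \int[leb]_h F x h)%E.
  pose G y : \bar R := (`|u x - u y| `^ p * nu' (y - x))%:E.
  have G0 y : (0 <= G y)%E by rewrite lee_fin mulr_ge0 ?powR_ge0.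
  have mG : measurable_fun setT G.
    apply/measurable_EFinP/measurable_funM.
      apply: (measurableT_comp (measurable_powR p)); apply: measurableT_comp => //.
      exact: measurable_funB.
    exact: (measurableT_comp mnu' (measurable_shift (- x))).
  have mNx : measurable ((+%R^~ (- x)) @^-1` N).
    by rewrite -[X in measurable X]setTI; exact: measurable_shift.
  transitivity (\int[leb]_y G y)%E.
    apply: (ge0_integral_eq_off_null mNx); first exact: etrans (leb_shift (- x) mN) N0.
    - move=> y; rewrite lee_fin; have [->|xy] := eqVneq x y.
        by rewrite subrr normr0 powR0// mul0r.
      by rewrite mulr_ge0 ?powR_ge0// nu_ge0// subr_eq0.
    - exact: G0.
    - move=> y Ny; rewrite /G; have [->|xy] := eqVneq x y.
        by rewrite subrr normr0 powR0// !mul0r.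
      by rewrite nuE// -[x - y]opprB nu_sym// subr_eq0 eq_sym.
  rewrite -(ge0_integral_shift x mG G0); apply: eq_integral => h _.
  by rewrite /G addrK /F [x + h]addrC.
rewrite /energy; under eq_integral do rewrite inner.
rewrite (fubini_tonelli (m2 := leb) (fun z => F z.1 z.2) mF)//=.
apply: eq_integral => h _; rewrite /F /incr -ge0_integralZl//.
- by apply: eq_integral => x _; rewrite -EFinM mulrC distrC.
- by have := measurable_incr_integrand p h 0 mu; under eq_fun do rewrite addr0.
- by rewrite lee_fin.
Qed.

Lemma measurable_enorm : measurable_fun setT (@enorm R d).
Proof.
apply: continuous_measurable_rV => x.
apply: (@continuous_comp _ _ _ sqnorm Num.sqrt); last exact: sqrt_continuous.
exact: (Ck_continuous (Ck_sqnorm 0)).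
Qed.

Lemma Levy_integral_borel :
  Levy_integral nu p = (\int[leb]_h ((nu' h)%:E * (Num.min 1 (enorm h `^ p))%:E))%E.
Proof.
have e0 : Num.min 1 (enorm (0 : Rd) `^ p) = 0.
  rewrite /enorm big1 ?sqrtr0 ?powR0 ?gt_eqF//; first by rewrite min_r ?ler01.
  by move=> i _; rewrite mxE expr0n.
have m0 (h : Rd) : 0 <= Num.min 1 (enorm h `^ p) by rewrite le_min ler01 powR_ge0.
apply: (ge0_integral_eq_off_null mN N0).
- move=> h; rewrite lee_fin; have [->|h0] := eqVneq h 0; first by rewrite e0 mul0r.
  by rewrite mulr_ge0// nu_ge0.
- by move=> h; rewrite -EFinM lee_fin mulr_ge0.
- by move=> h Nh; rewrite -EFinM nuE// mulrC.
Qed.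

Lemma Levy_integral_ge0 : (0 <= Levy_integral nu p)%E.
Proof.
rewrite Levy_integral_borel; apply: integral_ge0 => h _.
by rewrite -EFinM lee_fin mulr_ge0// le_min ler01 powR_ge0.
Qed.

End energy.

(** * Upper bound of the energy *)

Section upper.
Context {R : realType} {d : nat}.
Local Notation Rd := 'rV[R]_d.
Local Notation e i := (delta_mx ord0 i : Rd).

Lemma measurable_incr (p : R) (u : Rd -> R) : measurable_fun setT u ->
  measurable_fun setT (fun h => incr p u h).
Proof.
move=> mu.
pose F (z : Rd * Rd) : \bar R := (`|u (z.1 + z.2) - u z.1| `^ p)%:E.
have F0 z : (0 <= F z)%E by rewrite lee_fin powR_ge0.
apply: (measurable_fun_fubini_tonelli_G (m1 := leb) F _ F0).
apply/measurable_EFinP/(measurableT_comp (measurable_powR p)).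
apply: measurableT_comp => //; apply: measurable_funB.
  apply: (measurableT_comp mu); apply: measurable_addr_rV.
    exact: measurable_fst.
  exact: measurable_snd.
exact: (measurableT_comp mu measurable_fst).
Qed.

Lemma measurable_min_enorm (p : R) :
  measurable_fun setT (fun h : Rd => (Num.min 1 (enorm h `^ p))%:E).
Proof.
apply/measurable_EFinP/measurable_minr => //.
exact: (measurableT_comp (measurable_powR p) measurable_enorm).
Qed.

Lemma enorm_powR_le (p : R) (x : Rd) : 0 < p ->
  enorm x `^ p <= d%:R `^ p * \sum_i `|x ord0 i| `^ p.
Proof.
move=> p0; have := powR_sum_le p0 (fun i => normr_ge0 (x ord0 i)).
rewrite card_ord; apply: le_trans.
set S := \sum_i `|x ord0 i|; have S0 : 0 <= S by apply: sumr_ge0.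
rewrite (ge0_ler_powR (ltW p0)) ?nnegrE ?sqrtr_ge0//.
rewrite -(ger0_norm S0) -sqrtr_sqr ler_sqrt ?sqr_ge0// expr2 {1}/S mulr_suml.
apply: ler_sum => i _; rewrite -[x ord0 i ^+ 2]real_normK ?num_real// expr2.
by rewrite ler_wpM2l// /S (bigD1 i)//= lerDl sumr_ge0.
Qed.

Variables (nu nu' : Rd -> R) (N : set Rd).
Hypotheses (mN : measurable N) (N0 : leb N = 0%E).
Hypotheses (mnu' : measurable_fun setT nu') (nu'0 : forall h, 0 <= nu' h).
Hypothesis nuE : forall h, ~ N h -> nu' h = nu h.
Hypothesis nu_ge0 : forall h, h != 0 -> 0 <= nu h.
Hypothesis nu_sym : forall h, h != 0 -> nu (- h) = nu h.

Lemma energy_le (p : R) (u : Rd -> R) (G : \bar R) (k : R) : 0 < p ->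
  measurable_fun setT u -> (0 <= G)%E ->
  (forall i t, incr p u (t *: e i) <= (`|t| `^ p)%:E * G)%E ->
  (\int[leb]_x (`|u x| `^ p)%:E + G = k%:E)%E ->
  (energy nu p u <= ((2 `^ p * 2 + d%:R `^ p * d%:R) * k)%:E * Levy_integral nu p)%E.
Proof.
move=> p0 mu G0 uG kE; set C := 2 `^ p * 2 + d%:R `^ p * d%:R.
have C0 : 0 <= C by rewrite addr_ge0// mulr_ge0 ?powR_ge0.
have k0 : 0 <= k.
  rewrite -lee_fin -kE adde_ge0//; apply: integral_ge0 => x _.
  by rewrite lee_fin powR_ge0.
have m0 (h : Rd) : 0 <= Num.min 1 (enorm h `^ p) by rewrite le_min ler01 powR_ge0.
have mm := measurable_min_enorm p.
rewrite (energy_incr p0 mN N0 mnu' nu'0 nuE nu_ge0 nu_sym mu).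
rewrite (Levy_integral_borel p0 mN N0 nu'0 nuE nu_ge0).
have mI : measurable_fun setT (fun h => ((nu' h)%:E * (Num.min 1 (enorm h `^ p))%:E)%E).
  by apply: emeasurable_funM => //; exact/measurable_EFinP.
rewrite -ge0_integralZl//; last 2 first.
- by move=> h _; rewrite -EFinM lee_fin mulr_ge0.
- by rewrite lee_fin mulr_ge0.
apply: ge0_le_integral => //.
- by move=> h _; rewrite mule_ge0 ?lee_fin ?incr_ge0.
- by apply: emeasurable_funM; [exact/measurable_EFinP|exact: measurable_incr].
- exact: measurable_funeM.
move=> h _; apply: (@le_trans _ _ ((nu' h)%:E * (C%:E * ((Num.min 1 (enorm h `^ p))%:E * k%:E)))%E).
  by rewrite lee_wpmul2l ?lee_fin// -kE; exact: incr_le_min.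
by rewrite -!EFinM lee_fin le_eqVlt; apply/orP; left; apply/eqP; ring.
Qed.

(** If the energy is at most a multiple of the Sobolev norm to the power p, so is
    the nonlocal norm. *)
Lemma root_sum_le (p a : R) (L E K : \bar R) : 0 < p -> 0 <= a ->
  (0 <= L)%E -> (0 <= E)%E -> (L <= K)%E -> (E <= a%:E * K)%E ->
  ((L + E) `^ p^-1 <= ((1 + a) `^ p^-1)%:E * K `^ p^-1)%E.
Proof.
move=> p0 a0 L0 E0 LK EK; have K0 : (0 <= K)%E by exact: le_trans LK.
rewrite -poweR_EFin -poweRM ?lee_fin ?addr_ge0//.
apply: gt0_ler_poweR.
- by rewrite invr_ge0 ltW.
- by rewrite in_itv/= leey andbT adde_ge0.
- by rewrite in_itv/= leey andbT mule_ge0// lee_fin addr_ge0.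
by rewrite EFinD ge0_muleDl ?lee_fin// mul1e leeD.
Qed.

Lemma energy_ge0 (p : R) (u : Rd -> R) : 0 < p -> (0 <= energy nu p u)%E.
Proof.
move=> p0; apply: integral_ge0 => x _; apply: integral_ge0 => y _; rewrite lee_fin.
have [->|xy] := eqVneq x y; first by rewrite subrr normr0 powR0 ?mul0r ?gt_eqF.
by rewrite mulr_ge0 ?powR_ge0// nu_ge0// subr_eq0.
Qed.

Lemma embedding_of_energy_le (p a : R) (X : set (Rd -> R)) (normX : (Rd -> R) -> \bar R) :
  0 < p -> 0 <= a ->
  (forall u, X u -> exists k : R, [/\ u \in Lfun leb p%:E,
    normX u = (k%:E `^ p^-1)%E,
    (Lnorm leb p%:E (EFin \o u) `^ p <= k%:E)%E &
    (energy nu p u <= a%:E * k%:E)%E]) ->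
  continuous_embedding X normX (Wnu nu p) (Wnu_norm nu p).
Proof.
move=> p0 a0 H; split=> [u /H[k [uL _ _ Ek]]|].
  by split=> //; apply: le_lt_trans Ek _; rewrite -EFinM ltry.
exists ((1 + a) `^ p^-1) => u /H[k [_ -> Lk Ek]].
by apply: root_sum_le => //; [exact: poweR_ge0|exact: energy_ge0].
Qed.

Lemma W1p_embedding (p : R) : 1 < p -> (Levy_integral nu p < +oo)%E ->
  continuous_embedding (W1p p) (W1p_norm p) (Wnu nu p) (Wnu_norm nu p).
Proof.
move=> p1 Loo; have p1' := ltW p1; have p0 : 0 < p by rewrite (lt_trans _ p1).
have pn0 : p != 0 by rewrite gt_eqF.
have L0 := Levy_integral_ge0 p0 mN N0 nu'0 nuE nu_ge0.
have LE : Levy_integral nu p = (fine (Levy_integral nu p))%:E by rewrite fineK// ge0_fin_numE.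
set l := fine _ in LE; have l0 : 0 <= l by rewrite fine_ge0.
pose C : R := 2 `^ p * 2 + d%:R `^ p * d%:R.
have C0 : 0 <= C by rewrite addr_ge0// mulr_ge0 ?powR_ge0.
apply: (@embedding_of_energy_le _ (C * l)) => //; first exact: mulr_ge0.
move=> u [uL ug]; set g := get (weak_gradient p u).
have gP : weak_gradient p u g by case: ug => g' g'P; exact: (getPex (ex_intro _ g' g'P)).
have [mu uoo] := (Lfun_powRP u p1').1 uL.
have gL i := (Lfun_powRP (fun x => g x ord0 i) p1').1 (gP.1 i).
pose G := (\int[leb]_x (enorm (g x) `^ p)%:E)%E.
have P0 (x : R) : (0 <= (x `^ p)%:E)%E by rewrite lee_fin powR_ge0.
have G0 : (0 <= G)%E by apply: integral_ge0 => x _.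
have mg : measurable_fun setT g by apply: measurable_fun_rVP => i; case: (gL i).
have mgp : measurable_fun setT (fun x => (enorm (g x) `^ p)%:E).
  apply/measurable_EFinP/(measurableT_comp (measurable_powR p)).
  exact: (measurableT_comp measurable_enorm mg).
have mgi i : measurable_fun setT (fun x => (`|g x ord0 i| `^ p)%:E).
  apply/measurable_EFinP/(measurableT_comp (measurable_powR p)).
  by apply: measurableT_comp => //; case: (gL i).
have Goo : (G < +oo)%E.
  apply: (@le_lt_trans _ _ (\int[leb]_x ((d%:R `^ p)%:E * \sum_(i < d) (`|g x ord0 i| `^ p)%:E))%E).
    apply: ge0_le_integral => //.
    - by apply: measurable_funeM; apply: emeasurable_sum.
    - by move=> x _; rewrite sumEFin -EFinM lee_fin enorm_powR_le.
  rewrite ge0_integralZl//; last 2 first.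
  - by apply: emeasurable_sum.
  - by move=> x _; apply: sume_ge0.
  rewrite (ge0_integral_sum _ measurableT) => [|i|i x _]; [|exact: mgi|exact: P0].
  rewrite lte_mul_pinfty//; apply: lte_sum_pinfty => i _.
  by case: (gL i).
have uG i t : (incr p u (t *: e i) <= (`|t| `^ p)%:E * G)%E.
  apply: (le_trans (W1p_shift_le i t p1 uL gP)); rewrite lee_wpmul2l//.
  apply: ge0_le_integral => // x _; rewrite lee_fin.
  by rewrite (ge0_ler_powR (ltW p0)) ?nnegrE ?sqrtr_ge0 ?coord_le_enorm.
pose I := (\int[leb]_x (`|u x| `^ p)%:E)%E.
have I0 : (0 <= I)%E by apply: integral_ge0 => x _.
have kE : (I + G = (fine (I + G))%:E)%E.
  apply/esym/fineK; rewrite ge0_fin_numE; last exact: (adde_ge0 I0 G0).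
  exact: (lte_add_pinfty uoo Goo).
exists (fine (I + G)); split.
- exact: uL.
- by rewrite -kE /W1p_norm (Lnorm_powRE _ pn0).
- by rewrite -kE (Lnorm_powRE _ pn0) (leeDl _ G0).
have := energy_le p0 mu G0 uG kE; rewrite LE -!EFinM => /le_trans; apply.
by rewrite lee_fin /C le_eqVlt; apply/orP; left; apply/eqP; ring.
Qed.

Lemma BV_embedding : (Levy_integral nu 1 < +oo)%E ->
  continuous_embedding BV BV_norm (Wnu nu 1) (Wnu_norm nu 1).
Proof.
move=> Loo; have p0 : 0 < 1 :> R by [].
have L0 := Levy_integral_ge0 p0 mN N0 nu'0 nuE nu_ge0.
have LE : Levy_integral nu 1 = (fine (Levy_integral nu 1))%:E by rewrite fineK// ge0_fin_numE.
set l := fine _ in LE; have l0 : 0 <= l by rewrite fine_ge0.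
pose C : R := 2 `^ 1 * 2 + d%:R `^ 1 * d%:R.
have C0 : 0 <= C by rewrite addr_ge0// mulr_ge0 ?powR_ge0.
apply: (@embedding_of_energy_le _ (C * l)) => //; first exact: mulr_ge0.
move=> u uBV; have [uL uV] := uBV.
have [mu uoo] := (Lfun_powRP u (lexx 1)).1 uL.
have V0 := variation_ge0 u.
have uG i t : (incr 1 u (t *: e i) <= (`|t| `^ 1)%:E * Defs.variation u)%E.
  rewrite powRr1//; apply: le_trans (BV_shift_le i t uBV).
  rewrite le_eqVlt; apply/orP; left; apply/eqP; apply: eq_integral => x _.
  by rewrite powRr1.
pose I := (\int[leb]_x (`|u x| `^ 1)%:E)%E.
have I0 : (0 <= I)%E by apply: integral_ge0 => x _; rewrite lee_fin powR_ge0.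
have kE : (I + Defs.variation u = (fine (I + Defs.variation u))%:E)%E.
  by apply/esym/fineK; rewrite ge0_fin_numE; [exact: lte_add_pinfty|exact: adde_ge0].
exists (fine (I + Defs.variation u)); split.
- exact: uL.
- rewrite invr1 poweRe1 -kE; last exact: adde_ge0.
  by rewrite /BV_norm -[X in (X + _)%E]poweRe1 ?Lnorm_ge0// Lnorm_powRE.
- by rewrite -kE Lnorm_powRE// leeDl.
have := energy_le p0 mu V0 uG kE; rewrite LE -!EFinM => /le_trans; apply.
by rewrite lee_fin /C le_eqVlt; apply/orP; left; apply/eqP; ring.
Qed.

End upper.

(** * Test functions bounding the Levy integral *)

Section lower.
Context {R : realType} {d : nat}.
Local Notation Rd := 'rV[R]_d.

(** The quotient A / (A + B) of smooth functions, A positive exactly on |x|^2 < 2 r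
    and B exactly on |x|^2 > r, so that A + B does not vanish. *)
Lemma Cc_smooth_plateau (r : R) : 0 < r -> exists chi : Rd -> R, [/\ Cc_smooth chi,
  forall x, sqnorm x <= r -> chi x = 1 & forall x, 2 * r <= sqnorm x -> chi x = 0].
Proof.
move=> r0.
pose A (x : Rd) : R := flat 0 (2 * r + -1 * sqnorm x).
pose B (x : Rd) : R := flat 0 (sqnorm x + - r).
have AB0 x : A x + B x != 0.
  have [h|h] := ltP (sqnorm x) (2 * r).
    have A0 : 0 < A x by apply: flat0_gt0; lra.
    by rewrite gt_eqF// ltr_pwDl// flat_ge0.
  have B0 : 0 < B x by apply: flat0_gt0; lra.
  by rewrite gt_eqF// ltr_wpDl// flat_ge0.
have C1 n : Ck n A.
  apply: Ck_flat; apply: CkD; first exact: Ck_cst.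
  by apply: CkM; [exact: Ck_cst|exact: Ck_sqnorm].
have C2 n : Ck n B by apply: Ck_flat; apply: CkD; [exact: Ck_sqnorm|exact: Ck_cst].
have A0 x : 2 * r <= sqnorm x -> A x * (A x + B x)^-1 = 0.
  by move=> h; rewrite /A flat_le0 ?mul0r//; lra.
exists (fun x => A x * (A x + B x)^-1); split => //.
  apply/Cc_smoothP; split.
    by apply/smoothP => n; apply: CkM => //; apply: CkV => //; exact: CkD.
  exists (2 * r + 1) => x rx; apply: A0; have := norm_le_sqnorm x; lra.
move=> x h; have B0 : B x = 0 by rewrite /B flat_le0//; lra.
by have := AB0 x; rewrite B0 addr0 => h'; rewrite divff.
Qed.

Lemma sqnorm_add_le (x h : Rd) : sqnorm (x + h) <= 2 * sqnorm x + 2 * sqnorm h.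
Proof.
rewrite /sqnorm !mulr_sumr -big_split/=; apply: ler_sum => i _; rewrite mxE.
by have := sqr_ge0 (x ord0 i - h ord0 i); nra.
Qed.

Definition cube : set Rd :=
  [set x | forall i, (`[-1, 1]%classic : set (measurableTypeR R)) (x ord0 i)].

Lemma measurable_cube : measurable cube.
Proof. by apply: (measurable_box (A := fun=> `[-1, 1]%classic)) => i; exact: measurable_itv. Qed.

Lemma leb_cube : exists2 v : R, 0 < v & leb cube = v%:E.
Proof.
rewrite (leb_box (A := fun=> `[-1, 1]%classic)); last by move=> i; exact: measurable_itv.
elim/big_ind: _ => [|_ _ [a a0 ->] [b b0 ->]|i _].
- by exists 1.
- by exists (a * b); rewrite ?mulr_gt0// EFinM.
- exists 2 => //; rewrite lebesgue_measure_itv/= lte_fin ifT; last by lra.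
  by rewrite -EFinD; congr EFin; ring.
Qed.

Lemma sqnorm_cube x : cube x -> sqnorm x <= d%:R.
Proof.
move=> cx; rewrite -[X in X%:R]card_ord -sumr_const; apply: ler_sum => i _.
by have := cx i; rewrite /= in_itv/= => /andP[? ?]; nra.
Qed.

Lemma incr_ge_cube (p c v : R) (u : Rd -> R) (h : Rd) : measurable_fun setT u ->
  leb cube = v%:E -> 0 <= c -> (forall x, cube x -> c <= `|u (x + h) - u x| `^ p) ->
  ((c * v)%:E <= incr p u h)%E.
Proof.
move=> mu vE c0 H; have mc := measurable_cube.
have -> : (c * v)%:E = (\int[leb]_x (c%:E * (\1_cube x)%:E))%E.
  rewrite ge0_integralZl//; last exact/measurable_EFinP/measurable_indic.
  by rewrite integral_indic// setIT EFinM; congr (_ * _)%E; exact/esym/vE.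
apply: ge0_le_integral => //.
- by move=> x _; rewrite mule_ge0 ?lee_fin.
- by apply: measurable_funeM; exact/measurable_EFinP/measurable_indic.
- by have := measurable_incr_integrand p h 0 mu; under eq_fun do rewrite addr0.
move=> x _; rewrite -EFinM lee_fin indicE; have [xc|xc] := boolP (x \in cube).
  by rewrite mulr1; apply: H; rewrite inE in xc.
by rewrite mulr0 powR_ge0.
Qed.

(** Far from the origin, a bump on the cube is moved off the cube; near the
    origin, a compactly supported function equal to a coordinate around the cube
    is increased by that coordinate of h. *)
Lemma incr_ge_min (p : R) : (0 < d)%N -> 0 < p -> exists (u0 : Rd -> R) (u : 'I_d -> Rd -> R) (v : R),
  [/\ Cc_smooth u0, forall i, Cc_smooth (u i), 0 < v &
  forall h, ((Num.min 1 (enorm h `^ p) * v)%:E <=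
    incr p u0 h + (d%:R `^ p)%:E * \sum_(i < d) incr p (u i) h)%E].
Proof.
move=> d0 p0; have [v v0 vE] := leb_cube.
(* |x|^2 <= d on the cube; then |x + h|^2 >= |h|^2 / 2 - d >= 2 d if |h|^2 >= 6 d,
   and |x + h|^2 <= 2 d + 2 (6 d) = 14 d otherwise. *)
have dR0 : 0 < d%:R :> R by rewrite ltr0n.
have dR14 : 0 < 14 * d%:R :> R by rewrite mulr_gt0.
have [c0 [Cc0 c01 c00]] := Cc_smooth_plateau dR0.
have [c1 [Cc1 c11 _]] := Cc_smooth_plateau dR14.
pose u (i : 'I_d) (x : Rd) := x ord0 i * c1 x.
have Cu i : Cc_smooth (u i).
  by apply: Cc_smoothM => //; apply/smoothP => n; exact: Ck_coord.
exists c0, u, v; split => // h.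
have mu i := smooth_measurable (Cc_smooth_smooth (Cu i)).
have m0 := smooth_measurable (Cc_smooth_smooth Cc0).
have S0 : (0 <= (d%:R `^ p)%:E * \sum_(i < d) incr p (u i) h)%E.
  by rewrite mule_ge0 ?lee_fin ?powR_ge0//; apply: sume_ge0 => i _; exact: incr_ge0.
have [h6|h6] := leP (6 * d%:R) (sqnorm h).
  apply: (@le_trans _ _ (1 * v)%:E); first by rewrite lee_fin (ler_wpM2r (ltW v0))// ge_min lexx.
  apply: (@le_trans _ _ (incr p c0 h)); last by rewrite leeDl.
  apply: incr_ge_cube => // x cx; have xd := sqnorm_cube cx.
  rewrite (c01 x)// c00.
    by rewrite sub0r normrN normr1 powR1.
  have := sqnorm_add_le (x + h) (- x); rewrite addrAC subrr add0r.
  have -> : sqnorm (- x) = sqnorm x.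
    by apply: eq_bigr => i _; rewrite mxE sqrrN.
  lra.
apply: (@le_trans _ _ ((d%:R `^ p)%:E * \sum_(i < d) (`|h ord0 i| `^ p * v)%:E)%E).
  rewrite sumEFin -EFinM lee_fin -mulr_suml mulrA (ler_wpM2r (ltW v0))//.
  by rewrite ge_min enorm_powR_le ?orbT.
apply: (@le_trans _ _ ((d%:R `^ p)%:E * \sum_(i < d) incr p (u i) h)%E); last first.
  by rewrite leeDr// incr_ge0.
rewrite lee_wpmul2l ?lee_fin ?powR_ge0//; apply: lee_sum => i _.
apply: incr_ge_cube => // x cx.
have xd := sqnorm_cube cx; have := sqnorm_add_le x h => xh.
rewrite /u (c11 x); last by lra.
rewrite (c11 (x + h)); last by lra.
by rewrite !mulr1 mxE [x ord0 i + _]addrC addrK.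
Qed.

Variables (nu nu' : Rd -> R) (N : set Rd).
Hypotheses (mN : measurable N) (N0 : leb N = 0%E).
Hypotheses (mnu' : measurable_fun setT nu') (nu'0 : forall h, 0 <= nu' h).
Hypothesis nuE : forall h, ~ N h -> nu' h = nu h.
Hypothesis nu_ge0 : forall h, h != 0 -> 0 <= nu h.
Hypothesis nu_sym : forall h, h != 0 -> nu (- h) = nu h.

(** The d + 1 test functions dominating the truncated power have finite energy. *)
Lemma Levy_integral_lty (p : R) : (0 < d)%N -> 0 < p ->
  (forall u, Cc_smooth u -> (energy nu p u < +oo)%E) -> (Levy_integral nu p < +oo)%E.
Proof.
move=> d0 p0 H; have [u0 [u [v [C0 Cu v0 uv]]]] := incr_ge_min d0 p0.
have mu i := smooth_measurable (Cc_smooth_smooth (Cu i)).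
have m0 := smooth_measurable (Cc_smooth_smooth C0).
have EE w (mw : measurable_fun setT w) :=
  energy_incr p0 mN N0 mnu' nu'0 nuE nu_ge0 nu_sym mw.
have mnu'E : measurable_fun setT (EFin \o nu') by exact/measurable_EFinP.
have m_ w : measurable_fun setT w -> measurable_fun setT (fun h => (nu' h)%:E * incr p w h)%E.
  by move=> mw; apply: emeasurable_funM => //; exact: measurable_incr.
have pos w h : (0 <= (nu' h)%:E * incr p w h)%E by rewrite mule_ge0 ?lee_fin ?incr_ge0.
have min0 (h : Rd) : 0 <= Num.min 1 (enorm h `^ p) by rewrite le_min ler01 powR_ge0.
have mI : measurable_fun setT (fun h => ((nu' h)%:E * (Num.min 1 (enorm h `^ p))%:E)%E).
  by apply: emeasurable_funM => //; exact: measurable_min_enorm.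
have Lv : (Levy_integral nu p * v%:E <= energy nu p u0 + (d%:R `^ p)%:E * \sum_(i < d) energy nu p (u i))%E.
  rewrite (Levy_integral_borel p0 mN N0 nu'0 nuE nu_ge0) EE//.
  under eq_bigr do rewrite EE//.
  have m_i i := m_ _ (mu i).
  rewrite -ge0_integral_sum//.
  have mS : measurable_fun setT (fun h => \sum_(i < d) (nu' h)%:E * incr p (u i) h)%E.
    by apply: emeasurable_sum => i; exact: m_.
  have S0 h : (0 <= \sum_(i < d) (nu' h)%:E * incr p (u i) h)%E by apply: sume_ge0.
  rewrite -ge0_integralZl ?lee_fin ?powR_ge0//.
  have mZ := measurable_funeM (d%:R `^ p)%:E mS.
  have Z0 h : (0 <= (d%:R `^ p)%:E * \sum_(i < d) (nu' h)%:E * incr p (u i) h)%E.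
    by rewrite mule_ge0 ?lee_fin ?powR_ge0.
  have i0 h : (0 <= (nu' h)%:E * (Num.min 1 (enorm h `^ p))%:E)%E.
    by rewrite -EFinM lee_fin mulr_ge0.
  have v0E : (0 <= v%:E)%E by rewrite lee_fin ltW.
  have m0' := m_ _ m0.
  rewrite -ge0_integralD// muleC -ge0_integralZl//.
  have iv0 h : (0 <= v%:E * ((nu' h)%:E * (Num.min 1 (enorm h `^ p))%:E))%E.
    exact: mule_ge0.
  apply: ge0_le_integral => //.
  - exact: measurable_funeM.
  - exact: emeasurable_funD.
  move=> h _; rewrite muleC -muleA -EFinM -ge0_sume_distrr => [|i _]; last exact: incr_ge0.
  rewrite [X in (_ <= _ + X)%E]muleCA -ge0_muleDr ?incr_ge0//.
    by rewrite EFinM lee_wpmul2l ?lee_fin.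
  by rewrite mule_ge0 ?lee_fin ?powR_ge0//; apply: sume_ge0 => i _; exact: incr_ge0.
have Roo : (energy nu p u0 + (d%:R `^ p)%:E * \sum_(i < d) energy nu p (u i) < +oo)%E.
  apply: lte_add_pinfty; first exact: H.
  rewrite lte_mul_pinfty ?lee_fin ?powR_ge0//; apply: lte_sum_pinfty => i _; exact: H.
have := le_lt_trans Lv Roo; have := Levy_integral_ge0 p0 mN N0 nu'0 nuE nu_ge0.
by case: (Levy_integral nu p) => // [r|] _; rewrite ?ltry// gt0_mulye ?lte_fin.
Qed.

End lower.

Theorem theorem4p1 (R : realType) (d : nat) (d_gt0 : (0 < d)%N)
    (nu : 'rV[R]_d -> R)
    (nu_meas : lebesgue_measurable_fun [set~ 0] nu)
    (nu_ge0 : forall h, h != 0 -> 0 <= nu h)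
    (nu_sym : forall h, h != 0 -> nu (- h) = nu h) :
  (forall p : R, 1 < p ->
    [<-> (Levy_integral nu p < +oo)%E;
         continuous_embedding (W1p p) (W1p_norm p) (Wnu nu p) (Wnu_norm nu p);
         forall u, W1p p u -> (energy nu p u < +oo)%E;
         forall u, Cc_smooth u -> (energy nu p u < +oo)%E])
  /\
  [<-> (Levy_integral nu 1 < +oo)%E;
       continuous_embedding BV BV_norm (Wnu nu 1) (Wnu_norm nu 1);
       forall u, BV u -> (energy nu 1 u < +oo)%E;
       forall u, Cc_smooth u -> (energy nu 1 u < +oo)%E].
Proof.
have [nu' [N [mN N0 mnu' nu'0 nuE]]] := borel_version d_gt0 nu_meas nu_ge0.
split=> [p p1|]; tfae.
- exact: (W1p_embedding mN N0 mnu' nu'0 nuE nu_ge0 nu_sym p1).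
- by move=> [WW _] u /WW[].
- by move=> EW u Cu; apply: EW; apply: Cc_smooth_W1p => //; exact: ltW.
- exact: (Levy_integral_lty mN N0 mnu' nu'0 nuE nu_ge0 nu_sym d_gt0 (lt_trans ltr01 p1)).
- exact: (BV_embedding mN N0 mnu' nu'0 nuE nu_ge0 nu_sym).
- by move=> [WW _] u /WW[].
- by move=> EW u Cu; apply: EW; exact: Cc_smooth_BV.
- exact: (Levy_integral_lty mN N0 mnu' nu'0 nuE nu_ge0 nu_sym d_gt0 ltr01).
Qed.
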